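(* Let $p,q\ge1$, let $\vec w_1=(w_{1,1},\ldots,w_{1,p})$ and $\vec w_2=(w_{2,1},\ldots,w_{2,q})$ be two vectors of weights on $\mathbb R$, and let $\vec n=(n_1,\ldots,n_p)$, $\vec m=(m_1,\ldots,m_q)$ be multi-indices of positive integers with $|\vec n|=|\vec m|=n$. Suppose that $F_{\vec n}$ and $G_{\vec m}$ are both $n$-dimensional subspaces of $L^2(\mathbb R)$ and that $F_{\vec n}\cap G_{\vec m}^{\perp}=\{0\}$. Let $\phi_1,\ldots,\phi_n$ and $\psi_1,\ldots,\psi_n$ be biorthogonal bases of $F_{\vec n}$ and $G_{\vec m}$, and let $$K(x,y)=\sum_{j=1}^n\phi_j(x)\psi_j(y).$$ Let $Y$ be the solution of the Riemann-Hilbert problem described in the context. Then for real $x\ne y$, $$K(x,y)=\frac{1}{2\pi i(x-y)}\begin{bmatrix}0&\cdots&0&w_{2,1}(y)&\cdots&w_{2,q}(y)\end{bmatrix}Y_+^{-1}(y)\,Y_+(x)\begin{bmatrix}w_{1,1}(x)\\ \vdots\\ w_{1,p}(x)\\0\\ \vdots\\0\end{bmatrix},$$ where the row vector starts with $p$ zeros and the column vector ends with $q$ zeros.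
   Context: A weight on $\mathbb R$ is a function $w$ with $w(x)\ge 0$ for $x\in\mathbb R$ and $\int x^k w(x)\,dx<+\infty$ for every integer $k\ge 0$. $|\vec n|=\sum_i n_i$. $F_{\vec n}=\{\sum_{j=1}^pA_jw_{1,j}\mid A_j\text{ polynomial of degree}\le n_j-1\}$ and $G_{\vec m}=\{\sum_{j=1}^qB_jw_{2,j}\mid B_j\text{ polynomial of degree}\le m_j-1\}$; that these are subspaces of $L^2(\mathbb R)$ means that $x^jw_{1,k}\in L^2(\mathbb R)$ for $k=1,\ldots,p$, $j=0,\ldots,n_k-1$, and $x^jw_{2,k}\in L^2(\mathbb R)$ for $k=1,\ldots,q$, $j=0,\ldots,m_k-1$. $\perp$ is the orthogonal complement in $L^2(\mathbb R)$. Bases $\phi_1,\ldots,\phi_n$ of $F_{\vec n}$ and $\psi_1,\ldots,\psi_n$ of $G_{\vec m}$ are biorthogonal if $\int\phi_j(x)\psi_k(x)\,dx=\delta_{j,k}$; such bases exist under the stated hypotheses, and $K$ does not depend on their choice. Riemann-Hilbert problem: $Y:\mathbb C\setminus\mathbb R\to\mathbb C^{(p+q)\times(p+q)}$ satisfies: (1) $Y$ is analytic on $\mathbb C\setminus\mathbb R$; (2) for $x\in\mathbb R$, $Y_+(x)=Y_-(x)\begin{bmatrix}I_p&W(x)\\0&I_q\end{bmatrix}$ with $W=\vec w_1^{\,t}\vec w_2=(w_{1,j}w_{2,k})_{1\le j\le p,1\le k\le q}$; (3) as $z\to\infty$, $Y(z)=(I_{p+q}+O(1/z))\operatorname{diag}(z^{n_1},\ldots,z^{n_p},z^{-m_1},\ldots,z^{-m_q})$.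 Under the stated hypotheses this problem has a unique solution. $Y_\pm(x)$ denotes the limiting value of $Y(z)$ as $z\to x\in\mathbb R$ from the upper ($+$) or lower ($-$) half-plane, and $Y_+^{-1}(y)=(Y_+(y))^{-1}$; $I_r$ is the $r\times r$ identity matrix. *)

(* Defs.v *)
From HB Require Import structures.
From mathcomp Require Export all_boot all_order all_algebra.
From mathcomp Require Export all_classical all_reals all_analysis.
From mathcomp Require Export complex.

Set Implicit Arguments.
Unset Strict Implicit.
Unset Printing Implicit Defensive.
Import Order.TTheory GRing.Theory Num.Theory.
Import numFieldTopology.Exports numFieldNormedType.Exports.

Local Open Scope classical_set_scope.
Local Open Scope ring_scope.
Local Open Scope complex_scope.

Section Weights.
Variable R : realType.

Local Notation mu := (@lebesgue_measure R).

Definition is_weight (w : R -> R) : Prop :=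
  (forall x, 0 <= w x) /\
  forall k : nat, mu.-integrable [set: R] (fun x => (x ^+ k * w x)%:E).

(* [F_n = weighted_span w1 n] and [G_m = weighted_span w2 m].  The elements are
   honest functions, not classes modulo null sets, since the kernel built from
   them is evaluated pointwise; [size A <= n j] means [deg A <= n j - 1]. *)
Definition weighted_span (r : nat) (w : 'I_r -> R -> R) (n : 'I_r -> nat) :
    set (R -> R) :=
  [set f | exists A : 'I_r -> {poly R},
     (forall j, (size (A j) <= n j)%N) /\
     f = (fun x => \sum_j (A j).[x] * w j x)].

Definition L2 : set (R -> R) := [set f | f \in Lfun mu 2%:E].

(* Equality in L^2 is almost-everywhere equality, so linear independence and
   spanning are both understood modulo null sets. *)
Definition L2_basis (n : nat) (S : set (R -> R)) (e : 'I_n -> R -> R) : Prop :=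
  [/\ forall j, S (e j),
      forall c : 'I_n -> R,
        {ae mu, forall x, \sum_j c j * e j x = 0} -> forall j, c j = 0 &
      forall f, S f -> exists c : 'I_n -> R,
        {ae mu, forall x, f x = \sum_j c j * e j x}].

Definition L2_dim (n : nat) (S : set (R -> R)) : Prop :=
  exists e : 'I_n -> R -> R, L2_basis S e.

Definition L2_orth (S : set (R -> R)) : set (R -> R) :=
  [set f | L2 f /\ forall g, S g -> \int[mu]_x (f x * g x) = 0].

(* [S `&` T = {0}] inside L^2, for [S] and [T] containing 0. *)
Definition L2_trivial_meet (S T : set (R -> R)) : Prop :=
  forall f, S f -> T f -> {ae mu, forall x, f x = 0}.

Definition biorthogonal (n : nat) (phi psi : 'I_n -> R -> R) : Prop :=
  forall j k, \int[mu]_x (phi j x * psi k x) = (j == k)%:R.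

Definition CD_kernel (n : nat) (phi psi : 'I_n -> R -> R) (x y : R) : R :=
  \sum_j phi j x * psi j y.

End Weights.
Arguments L2 : clear implicits.

Section RiemannHilbert.
Variable R : realType.
Local Notation C := (R[i] : numFieldType).

Definition upper_half_plane : set C := [set z | 0 < complex.Im z].
Definition lower_half_plane : set C := [set z | complex.Im z < 0].

Definition analytic_off_R (f : C -> C) : Prop :=
  forall z : C, complex.Im z != 0 -> @derivable C C^o C^o f z 1.

(* The limits are unrestricted limits within the open half-plane, required at
   every real point; values of [Y] on the real line itself are irrelevant. *)
Section BoundaryValues.
Variables (r : nat) (Y : C -> 'M[C]_r).

Definition has_boundary_values (H : set C) : Prop :=
  forall (x : R) i j, cvg (Y z i j @[z --> within H (nbhs (x%:C : C))]).

Definition boundary_value (H : set C) (x : R) : 'M[C]_r :=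
  \matrix_(i, j) lim (Y z i j @[z --> within H (nbhs (x%:C : C))]).

End BoundaryValues.

Definition Yplus (r : nat) (Y : C -> 'M[C]_r) : R -> 'M[C]_r :=
  boundary_value Y upper_half_plane.
Definition Yminus (r : nat) (Y : C -> 'M[C]_r) : R -> 'M[C]_r :=
  boundary_value Y lower_half_plane.

Variables (p q : nat).
Variables (w1 : 'I_p -> R -> R) (w2 : 'I_q -> R -> R).
Variables (n : 'I_p -> nat) (m : 'I_q -> nat).

Definition RH_jump (x : R) : 'M[C]_(p + q) :=
  block_mx 1%:M (\matrix_(j, k) (w1 j x * w2 k x)%:C) 0 1%:M.

Definition RH_growth (z : C) : 'M[C]_(p + q) :=
  diag_mx (row_mx (\row_j z ^+ n j) (\row_k z ^- m k)).

Definition is_RH_solution (Y : C -> 'M[C]_(p + q)) : Prop :=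
  [/\ forall i j, analytic_off_R (fun z => Y z i j),
      has_boundary_values Y upper_half_plane /\
        has_boundary_values Y lower_half_plane,
      forall x : R, Yplus Y x = Yminus Y x *m RH_jump x &
      exists (E : C -> 'M[C]_(p + q)) (c M : R), 0 < M /\
        forall z : C, complex.Im z != 0 -> M%:C <= `|z| ->
          (forall i j, `|E z i j| <= c%:C / `|z|) /\
          Y z = (1%:M + E z) *m RH_growth z].

End RiemannHilbert.

(* Main.v *)
(* Write V = Y^-1.  The jump condition makes the last q rows of V polynomial
   (Liouville), and for Im z > 0 the relation V(z) Y(z) = I makes
     sum_i (sum_k w_{2,k}(y) V_{p+k,i}(y)) Y_{ij}(z) = (y - z) g(y),   g in G_m,
   because the polynomials in y on the left vanish at y = z.  Expand
   g = sum_b c_b psi_b.  For phi_l = sum_j A_{lj} w_{1,j}, the function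
     h = sum_j' A_{lj'} (sum_i V_{j'i} Y_{ij}(z))
   decays like 1/u at infinity, satisfies h(z) = A_{lj}(z), and jumps across R by
   -phi_l(y) (y - z) g(y); so Cauchy's formula and biorthogonality give
   c_l = - 2 pi i A_{lj}(z).  Letting z tend to x from above and summing against
   w_{1,j}(x) yields the kernel.

   Functions analytic off R are only assumed complex differentiable there, with
   continuous boundary values on R; Cauchy's formula is obtained from Goursat's
   theorem on rectangles one of whose sides lies on R. *)
Require Import Defs.
From mathcomp Require Import perm ring lra.
Set Implicit Arguments.
Unset Strict Implicit.
Unset Printing Implicit Defensive.
Import Order.TTheory GRing.Theory Num.Theory.
Import numFieldTopology.Exports numFieldNormedType.Exports.
Local Open Scope classical_set_scope.
Local Open Scope ring_scope.
Local Open Scope complex_scope.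

(** Two degree counts drive the argument. For large [|z|] the product of [RH_growth] with [V] is
    bounded, so row [p + k] of [V] is [O(z^(m_k))] and row [j] is [O(z^(-n_j))]. The first count
    bounds the polynomials by degree [m_k], and division by [y - z] leaves degree at most [m_k - 1],
    which is what the (complexified) span [G_m] asks for. The second beats [A_lj], of degree at most
    [n_j - 1], by one power. The factor [y - z] in the jump cancels the Cauchy kernel; this is why
    Cauchy's formula becomes the pairing of [phi_l] with [g]. The inverse is available because
    [det Y] has no jump and is bounded at infinity: the jump matrix has determinant 1, and so has
    the growth matrix, since [|n| = |m|]. The kernel formula is pointwise, while an [L^2] basis
    expands its span only almost everywhere. The expansion of [g] is therefore derived by linear
    algebra on polynomial coefficients, and it holds at every real [y]. *)

Section SegmentIntegral.
Variable R : realType.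
Implicit Types (f g F : R -> R) (a b c M : R).
Local Notation mu := (@lebesgue_measure R).

(** The integral is not oriented: for [b < a] the segment is empty and the value is [0], hence the
    order hypotheses in the lemmas. *)
Definition sint f a b : R := \int[mu]_(x in `[a, b]) f x.

Lemma continuous_integrable_segment f a b : continuous f ->
  mu.-integrable `[a, b] (EFin \o f).
Proof.
move=> cf; apply: continuous_compact_integrable; first exact: segment_compact.
exact: continuous_subspaceT.
Qed.

Lemma sintD f g a b : continuous f -> continuous g ->
  sint (fun x => f x + g x) a b = sint f a b + sint g a b.
Proof. by move=> cf cg; apply: RintegralD => //; exact: continuous_integrable_segment. Qed.

Lemma sintB f g a b : continuous f -> continuous g ->
  sint (fun x => f x - g x) a b = sint f a b - sint g a b.
Proof. by move=> cf cg; apply: RintegralB => //; exact: continuous_integrable_segment. Qed.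

Lemma sint_add f a b c : continuous f -> a <= c -> c <= b ->
  sint f a b = sint f a c + sint f c b.
Proof.
move=> cf ac cb; have := @Rintegral_itvB R f (BLeft a) (BRight b) c
  (continuous_integrable_segment a b cf).
rewrite !bnd_simp => /(_ ac cb).
rewrite Rintegral_itv_obnd_cbnd; last first.
  by apply: integrableS (continuous_integrable_segment a b cf) => //;
    apply: subset_itvr; rewrite bnd_simp.
by rewrite /sint => <-; rewrite addrC subrK.
Qed.

Lemma sint_same f a : sint f a a = 0.
Proof. by rewrite /sint set_itv1 Rintegral_set1. Qed.

Lemma sint_bound f a b M : continuous f -> a <= b ->
  (forall x, a < x < b -> `|f x| <= M) -> `|sint f a b| <= M * (b - a).
Proof.
move=> cf ab fM; rewrite /sint -Rintegral_itv_bndo_bndc; last first.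
  by apply: integrableS (continuous_integrable_segment a b cf) => //;
    apply: subset_itvl; rewrite bnd_simp.
have ioo : mu.-integrable `]a, b[ (EFin \o f).
  by apply: integrableS (continuous_integrable_segment a b cf) => //;
    apply: subset_itv; rewrite bnd_simp.
rewrite -Rintegral_itv_obnd_cbnd//.
have ci : mu.-integrable `]a, b[ (EFin \o (fun=> M)).
  apply: (@integrableS _ _ _ mu `[a, b]) => //.
    by apply: subset_itv; rewrite bnd_simp.
  by apply: continuous_integrable_segment => x; exact: cvg_cst.
apply: le_trans (le_normr_Rintegral _ ioo) _ => //.
apply: (@le_trans _ _ (\int[mu]_(x in `]a, b[) M)).
  apply: le_Rintegral => //; first exact: (@integrable_abse _ _ _ mu _ (EFin \o f)).
rewrite Rintegral_cst//= lebesgue_measure_itv/= lte_fin.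
case: ltP => //= ba; suff -> : b = a by rewrite subrr !mulr0.
by apply/le_anti; rewrite ab ba.
Qed.

Lemma sint_FTC f F a b : continuous f -> (forall x : R, is_derive x 1 F (f x)) ->
  a <= b -> sint f a b = F b - F a.
Proof.
move=> cf dF; rewrite le_eqVlt => /predU1P[->|ab]; first by rewrite sint_same subrr.
have dF' (x : R) : derivable F x 1 by apply: ex_derive.
have cF x : {for x, continuous F}.
  by apply: differentiable_continuous; apply/derivable1_diffP.
rewrite /sint /Rintegral (@continuous_FTC2 _ f F)//.
- exact: continuous_subspaceT.
- split => //.
  + by apply: cvg_at_right_filter; exact: cF.
  + by apply: cvg_at_left_filter; exact: cF.
- by move=> x _; rewrite derive1E; apply: derive_val.
Qed.

(** Needed to let a horizontal side of a rectangle approach a line on which the integrand is merely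
    continuous. *)
Lemma sint_continuous (u : R -> R -> R) a b :
  continuous (fun p : R * R => u p.1 p.2) ->
  continuous (fun t => sint (u t) a b).
Proof.
move=> cu t.
have cux s : continuous (u s).
  move=> x; have h : (fun y : R => (s, y)) @ x --> (s, x).
    by apply: (@cvg_pair _ _ _ (nbhs x) (nbhs s) (nbhs x) _ _ _ (fun=> s) id);
      [exact: cvg_cst | exact: cvg_id].
  exact: (@cvg_comp _ _ _ _ (fun p => u p.1 p.2) _ _ (nbhs (u s x)) h (cu (s, x))).
have cut x : continuous (u ^~ x).
  move=> s; have h : (fun y : R => (y, x)) @ s --> (s, x).
    by apply: (@cvg_pair _ _ _ (nbhs s) (nbhs s) (nbhs x) _ _ _ id (fun=> x));
      [exact: cvg_id | exact: cvg_cst].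
  exact: (@cvg_comp _ _ _ _ (fun p => u p.1 p.2) _ _ (nbhs (u s x)) h (cu (s, x))).
(* The maximum of [|u|] on this compact box is a constant dominating function for all parameters
   within distance 1 of [t]. *)
pose K : set (R * R) := `[t - 1, t + 1] `*` `[a, b].
have cK : compact K by apply: compact_setX; exact: segment_compact.
have [ab|ba] := leP a b; last first.
  rewrite (_ : (fun _ => _) = fun=> 0); first exact: cvg_cst.
  by apply/funext => s; rewrite /sint set_itv_ge ?Rintegral_set0 ?bnd_simp -?ltNge.
have [p Kp pM] : exists2 p, p \in K & forall q, q \in K -> `|u q.1 q.2| <= `|u p.1 p.2|.
  apply: (@compact_EVT_max _ R (fun p => `|u p.1 p.2|)) => //.
    by exists (t, a); split => //=; rewrite in_itv /= ?lexx ?ab // lerDl lerBlDr lerDl ler01.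
  apply: continuous_subspaceT.
  by move=> q; exact: (cvg_comp _ _ (cu q) (@norm_continuous R R _)).
apply: (@continuity_under_integral _ _ _ mu u `[a, b] _ (t - 1) (t + 1) _ _ (fun=> `|u p.1 p.2|)) => //.
- by move=> s _; exact: continuous_integrable_segment.
- by apply: aeW => x _ s _; exact: cut.
- by apply: continuous_integrable_segment => x; exact: cvg_cst.
- move=> s /= Is; apply: aeW => x Bx; apply: (pM (s, x)); rewrite inE; split => //=.
  by move: Is; rewrite /= !in_itv /= => /andP[/ltW-> /ltW->].
- by rewrite inE /= in_itv /= ltrBlDr !ltrDl ltr01.
Qed.

End SegmentIntegral.

(** * Real-valued modulus and the topology of the complex plane *)

Section ComplexTopology.
Variable R : realType.
Local Notation C := (R[i] : numFieldType).
Local Notation Re := (@complex.Re R).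
Local Notation Im := (@complex.Im R).

(** The norm of [R[i]] takes its values in [R[i]]; this real version makes the order of [R] and
    [lra] applicable. *)
Definition cabs (z : R[i]) : R := Re `|z|.

Lemma cabsE (z : R[i]) : `|z| = (cabs z)%:C.
Proof. by rewrite /cabs normc_def. Qed.

Lemma cabs_le (z : R[i]) (x : R) : (`|z| <= x%:C) = (cabs z <= x).
Proof. by rewrite cabsE lecR. Qed.

Lemma cabs_lt (z : R[i]) (x : R) : (`|z| < x%:C) = (cabs z < x).
Proof. by rewrite cabsE ltcR. Qed.

Lemma cabs_ge0 z : 0 <= cabs z.
Proof. by rewrite -ler0c -cabsE normr_ge0. Qed.

Lemma cabsM z w : cabs (z * w) = cabs z * cabs w.
Proof. by apply: complexI; rewrite -cabsE normrM !cabsE -rmorphM. Qed.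

Lemma cabsX z k : cabs (z ^+ k) = cabs z ^+ k.
Proof. by apply: complexI; rewrite -cabsE normrX !cabsE -rmorphXn. Qed.

Lemma cabsV z : cabs z^-1 = (cabs z)^-1.
Proof. by apply: complexI; rewrite -cabsE normfV !cabsE fmorphV. Qed.

Lemma cabsD z w : cabs (z + w) <= cabs z + cabs w.
Proof. by rewrite -cabs_le rmorphD /= -!cabsE ler_normD. Qed.

Lemma cabsN z : cabs (- z) = cabs z.
Proof. by rewrite /cabs normrN. Qed.

Lemma cabsB z w : cabs (z - w) <= cabs z + cabs w.
Proof. by rewrite -(cabsN w) cabsD. Qed.

Lemma cabs_distr z w : cabs (z - w) = cabs (w - z).
Proof. by rewrite /cabs distrC. Qed.

Lemma cabs0 : cabs 0 = 0.
Proof. by rewrite /cabs normr0. Qed.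

Lemma cabs_eq0 z : (cabs z == 0) = (z == 0).
Proof. by rewrite -(normr_eq0 z) cabsE -[0 in RHS]/((0 : R)%:C) (inj_eq (@complexI R)). Qed.

Lemma cabs_gt0 z : (0 < cabs z) = (z != 0).
Proof. by rewrite lt_neqAle cabs_ge0 andbT eq_sym cabs_eq0. Qed.

Lemma cabs_real (x : R) : cabs x%:C = `|x|.
Proof. by rewrite /cabs normc_def /= expr0n /= addr0 sqrtr_sqr. Qed.

Lemma cabs_Re z : `|Re z| <= cabs z.
Proof. by rewrite /cabs normc_def /= -sqrtr_sqr ler_wsqrtr// lerDl sqr_ge0. Qed.

Lemma cabs_Im z : `|Im z| <= cabs z.
Proof. by rewrite /cabs normc_def /= -sqrtr_sqr ler_wsqrtr// lerDr sqr_ge0. Qed.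

Lemma cabs_ReIm z : cabs z <= `|Re z| + `|Im z|.
Proof.
rewrite {1}[z]complexE; apply: le_trans (cabsD _ _) _.
rewrite cabsM !cabs_real lerD2l (_ : cabs 'i = 1) ?mul1r//.
by rewrite /cabs normc_def /= expr0n /= add0r expr1n sqrtr1.
Qed.

Lemma RecB (z w : R[i]) : Re (z - w) = Re z - Re w.
Proof. by case: z; case: w. Qed.
Lemma ImcB (z w : R[i]) : Im (z - w) = Im z - Im w.
Proof. by case: z; case: w. Qed.
Lemma RecD (z w : R[i]) : Re (z + w) = Re z + Re w.
Proof. by case: z; case: w. Qed.
Lemma ImcD (z w : R[i]) : Im (z + w) = Im z + Im w.
Proof. by case: z; case: w. Qed.
Lemma ImcM (z w : R[i]) : Im (z * w) = Re z * Im w + Im z * Re w.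
Proof. by case: z; case: w. Qed.

Lemma gt0_realC (e : R[i]) : 0 < e -> exists2 d : R, 0 < d & e = d%:C.
Proof.
move=> e0; have eR : e \is Num.real by exact: gtr0_real.
by exists (Re e); rewrite ?(RRe_real eR)// -ltcR (RRe_real eR).
Qed.

Lemma cvg_cabsP (T : Type) (F : set_system T) {FF : Filter F} (f : T -> C) (l : C) :
  f @ F --> l <-> forall e : R, 0 < e -> \forall x \near F, cabs (f x - l) <= e.
Proof.
split.
  move=> /cvgrPdist_le fl e e0.
  have e0' : 0 < e%:C :> C by rewrite ltcR.
  apply: filterS (fl _ e0') => x.
  by rewrite distrC cabs_le.
move=> fl; apply/cvgrPdist_le => e /gt0_realC[d d0 ->].
by apply: filterS (fl _ d0) => x; rewrite -cabs_le distrC.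
Qed.

Lemma nbhs_cabsP (z : C) (P : set C) :
  nbhs z P <-> exists2 d : R, 0 < d & forall w, cabs (w - z) < d -> P w.
Proof.
split.
  move=> /nbhs_normP[e /= /gt0_realC[d d0 ->] H].
  by exists d => // w wz; apply: H => /=; rewrite distrC cabs_lt.
move=> [d d0 H]; apply/nbhs_normP; exists d%:C => /=; first by rewrite ltcR.
by move=> w /=; rewrite distrC cabs_lt; exact: H.
Qed.

Lemma continuous_Re : continuous (Re : C -> R).
Proof.
move=> z; apply/(@cvgrPdist_le _ _ _ _ (nbhs_filter (z : C))) => e e0; apply/nbhs_cabsP; exists e => // w wz.
by rewrite distrC -RecB (le_trans (cabs_Re _))// ltW.
Qed.

Lemma continuous_Im : continuous (Im : C -> R).
Proof.
move=> z; apply/(@cvgrPdist_le _ _ _ _ (nbhs_filter (z : C))) => e e0; apply/nbhs_cabsP; exists e => // w wz.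
by rewrite distrC -ImcB (le_trans (cabs_Im _))// ltW.
Qed.

Lemma continuous_Complex : continuous (fun p : R * R => (p.1 +i* p.2 : C)).
Proof.
move=> [a b]; apply/cvg_cabsP => e e0.
exists ([set x | `|x - a| < e / 2], [set y | `|y - b| < e / 2]) => /=.
  have e20 : 0 < e / 2 by rewrite divr_gt0.
  by split; apply/nbhs_normP; exists (e / 2) => // w /=; rewrite distrC.
move=> [x y] /= [xa yb]; rewrite (le_trans (cabs_ReIm _))//= [leRHS]splitr.
by rewrite lerD// ltW.
Qed.

Lemma continuous_horiz (c : R) : continuous (fun x : R => (x +i* c : C)).
Proof.
move=> a; apply/cvg_cabsP => e e0; apply/nbhs_normP; exists e => // x /= xa.
by rewrite (le_trans (cabs_ReIm _))//= subrr normr0 addr0 distrC ltW.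
Qed.

Lemma continuous_vert (c : R) : continuous (fun y : R => (c +i* y : C)).
Proof.
move=> a; apply/cvg_cabsP => e e0; apply/nbhs_normP; exists e => // x /= xa.
by rewrite (le_trans (cabs_ReIm _))//= subrr normr0 add0r distrC ltW.
Qed.

(** The scalars are complex, so derivability in the single direction [1] is complex
    differentiability, and the difference quotient controls every increment [w - z]. *)
Lemma derivable_cabsP (f : C -> C) (z : C) : @derivable C C^o C^o f z 1 ->
  forall e : R, 0 < e -> exists2 d : R, 0 < d &
    forall w, cabs (w - z) < d ->
      cabs (f w - f z - ('D_1 f z : C) * (w - z)) <= e * cabs (w - z).
Proof.
move=> df e e0.
move: df => /cvg_cabsP /(_ e e0) /nbhs_cabsP[d d0 H]; exists d => // w wd.
have [->|wz] := eqVneq w z; first by rewrite !subrr mulr0 subrr cabs0 mulr0.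
have wz0 : w - z != 0 by rewrite subr_eq0.
have := H (w - z); rewrite subr0 => /(_ wd wz0) /=.
rewrite [_%:A]mulr1 subrK -[_ *: _]/(_ * _) => Hw.
have -> : f w - f z - 'D_1 f z * (w - z) =
   ((w - z)^-1 * (f w - f z) - 'D_1 f z) * (w - z) by field.
by rewrite cabsM ler_wpM2r ?cabs_ge0.
Qed.

Lemma derivable_continuous (f : C -> C) (z : C) :
  @derivable C C^o C^o f z 1 -> {for z, continuous f}.
Proof. by move=> /derivable1_diffP/differentiable_continuous. Qed.

End ComplexTopology.

(** * Contour integrals around rectangles *)

Section Rectangles.
Variable R : realType.
Local Notation C := (R[i] : numFieldType).
Local Notation Re := (@complex.Re R).
Local Notation Im := (@complex.Im R).
Implicit Types (f g : C -> C) (a b c d : R).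

(* The real part of the integral of [f z dz] around the rectangle with lower
   left corner [a + ic] and upper right corner [b + id]; the imaginary part is
   obtained from [- i f]. *)
Definition rect_int f a b c d : R :=
  sint (fun x => Re (f (x +i* c))) a b - sint (fun y => Im (f (b +i* y))) c d
  - sint (fun x => Re (f (x +i* d))) a b + sint (fun y => Im (f (a +i* y))) c d.

Lemma continuous_Re_horiz f c : continuous f -> continuous (fun x : R => Re (f (x +i* c))).
Proof.
move=> cf x; apply: (cvg_comp _ _ (cvg_comp _ _ (@continuous_horiz R c x) (cf _))).
exact: continuous_Re.
Qed.

Lemma continuous_Im_vert f c : continuous f -> continuous (fun y : R => Im (f (c +i* y))).
Proof.
move=> cf x; apply: (cvg_comp _ _ (cvg_comp _ _ (@continuous_vert R c x) (cf _))).
exact: continuous_Im.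
Qed.

Let crh := continuous_Re_horiz.
Let civ := continuous_Im_vert.

Lemma rect_int_hsplit f a b c d e : continuous f -> a <= e -> e <= b ->
  rect_int f a b c d = rect_int f a e c d + rect_int f e b c d.
Proof.
move=> cf ae eb; rewrite /rect_int.
rewrite (sint_add (@crh f c cf) ae eb) (sint_add (@crh f d cf) ae eb); lra.
Qed.

Lemma rect_int_vsplit f a b c d e : continuous f -> c <= e -> e <= d ->
  rect_int f a b c d = rect_int f a b c e + rect_int f a b e d.
Proof.
move=> cf ae eb; rewrite /rect_int.
rewrite (sint_add (@civ f a cf) ae eb) (sint_add (@civ f b cf) ae eb); lra.
Qed.

Lemma rect_intB f g a b c d : continuous f -> continuous g ->
  rect_int (fun z => f z - g z) a b c d = rect_int f a b c d - rect_int g a b c d.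
Proof.
move=> cf cg; rewrite /rect_int.
have H k : sint (fun x => Re (f (x +i* k) - g (x +i* k))) a b =
    sint (fun x => Re (f (x +i* k))) a b - sint (fun x => Re (g (x +i* k))) a b.
  rewrite -(sintB a b (@crh f k cf) (@crh g k cg)); congr (sint _ a b).
  by apply/funext => x; rewrite RecB.
have V k : sint (fun y => Im (f (k +i* y) - g (k +i* y))) c d =
    sint (fun y => Im (f (k +i* y))) c d - sint (fun y => Im (g (k +i* y))) c d.
  rewrite -(sintB c d (@civ f k cf) (@civ g k cg)); congr (sint _ c d).
  by apply/funext => x; rewrite ImcB.
by rewrite !H !V; ring.
Qed.

Lemma sint_affine (p q a b : R) : a <= b ->
  sint (fun x => p * x + q) a b = p * (b ^+ 2 - a ^+ 2) / 2 + q * (b - a).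
Proof.
move=> ab; have dF (x : R) : is_derive x 1 (fun x : R => p / 2 * x ^+ 2 + q * x) (p * x + q).
  by apply: is_derive_eq; rewrite /GRing.scale /=; field.
rewrite (sint_FTC _ dF ab); first by field.
by move=> x; apply: cvgD; [apply: cvgM; [exact: cvg_cst|exact: cvg_id]|exact: cvg_cst].
Qed.

(** An affine function has a primitive. Here the four sides are computed explicitly; the result lets
    Goursat's argument subtract a first-order expansion. *)
Lemma rect_int_affine (A B z0 : C) a b c d : a <= b -> c <= d ->
  rect_int (fun z => B + A * (z - z0)) a b c d = 0.
Proof.
move: A B z0 => [A1 A2] [B1 B2] [x0 y0] ab cd; rewrite /rect_int /=.
have E1 (k : R) : (fun x => B1 + (A1 * (x - x0) - A2 * (k - y0))) =
  (fun x => A1 * x + (B1 - A1 * x0 - A2 * (k - y0))) by apply/funext => x; ring.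
have E2 (k : R) : (fun y => B2 + (A1 * (y - y0) + A2 * (k - x0))) =
  (fun y => A1 * y + (B2 - A1 * y0 + A2 * (k - x0))) by apply/funext => x; ring.
by rewrite !E1 !E2 !sint_affine//; field.
Qed.

(** Maximum times perimeter. *)
Lemma rect_int_bound f a b c d (M : R) : continuous f -> a <= b -> c <= d ->
  (forall z, a <= Re z <= b -> c <= Im z <= d -> cabs (f z) <= M) ->
  `|rect_int f a b c d| <= 2 * M * ((b - a) + (d - c)).
Proof.
move=> cf ab cd fM.
have H (k : R) : c <= k <= d -> `|sint (fun x => Re (f (x +i* k))) a b| <= M * (b - a).
  move=> kd; apply: sint_bound => //; first exact: crh.
  move=> x /andP[/ltW ax /ltW xb]; apply: le_trans (cabs_Re _) _.
  by apply: fM => //=; rewrite ax.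
have V (k : R) : a <= k <= b -> `|sint (fun y => Im (f (k +i* y))) c d| <= M * (d - c).
  move=> kd; apply: sint_bound => //; first exact: civ.
  move=> x /andP[/ltW ax /ltW xb]; apply: le_trans (cabs_Im _) _.
  by apply: fM => //=; rewrite ax.
have := H c; have := H d; have := V a; have := V b.
rewrite !lexx ab cd /= => /(_ isT) + /(_ isT) + /(_ isT) + /(_ isT).
rewrite /rect_int !ler_norml => /andP[? ?] /andP[? ?] /andP[? ?] /andP[? ?].
by apply/andP; split; lra.
Qed.

End Rectangles.

(** * Goursat's theorem by bisection *)

Section Goursat.
Variable R : realType.
Local Notation C := (R[i] : numFieldType).
Local Notation Re := (@complex.Re R).
Local Notation Im := (@complex.Im R).
Implicit Types (f g : C -> C) (a b c d : R).

Lemma continuous_affine (A B z0 : C) : continuous (fun z : C => B + A * (z - z0)).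
Proof.
move=> z; exact: (cvgD (cvg_cst B) (cvgM (cvg_cst A) (cvgB cvg_id (cvg_cst z0)))).
Qed.

Lemma sup_nested (u v : nat -> R) : (forall k, u k <= u k.+1) ->
  (forall k, v k.+1 <= v k) -> (forall k, u k <= v k) ->
  exists x, forall k, u k <= x <= v k.
Proof.
move=> u_incr v_decr uv.
have uleq k l : u k <= u (k + l)%N.
  by elim: l => [|l IH]; rewrite ?addn0// addnS (le_trans IH).
have vleq k l : v (k + l)%N <= v k.
  by elim: l => [|l IH]; rewrite ?addn0// addnS (le_trans _ IH).
have uvkl k l : u k <= v l.
  by apply: le_trans (uleq k l) (le_trans (uv _) _); rewrite addnC vleq.
exists (sup (range u)) => k; apply/andP; split.
  apply: sup_upper_bound; last by exists k.
  by split; [exists (u 0%N); exists 0%N | exists (v 0%N) => _ [l _ <-]].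
by apply: sup_le_ub; [exists (u 0%N); exists 0%N | move=> _ [l _ <-]].
Qed.

(** A rectangle is coded as a single tuple so that the bisection can be run by iterating one choice
    function. *)
Let left (q : R * R * (R * R)) := q.1.1.
Let right (q : R * R * (R * R)) := q.1.2.
Let bottom (q : R * R * (R * R)) := q.2.1.
Let top (q : R * R * (R * R)) := q.2.2.
Let rint f q := rect_int f (left q) (right q) (bottom q) (top q).

(** The integrals over the four quarters add up to the whole, so they cannot all be smaller than a
    quarter of it in absolute value. *)
Lemma rect_int_quarter f q : continuous f -> left q <= right q -> bottom q <= top q ->
  exists q', [/\ left q <= left q' <= right q' /\ right q' <= right q,
    bottom q <= bottom q' <= top q' /\ top q' <= top q,
    right q' - left q' = (right q - left q) / 2,
    top q' - bottom q' = (top q - bottom q) / 2 &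
    `|rint f q| <= 4 * `|rint f q'|].
Proof.
case: q => [[a b] [c d]]; rewrite /left/right/bottom/top/rint/= => cf ab cd.
pose m := (a + b) / 2; pose n := (c + d) / 2.
have am : a <= m by rewrite /m; lra.
have mb : m <= b by rewrite /m; lra.
have cn : c <= n by rewrite /n; lra.
have nd : n <= d by rewrite /n; lra.
have m1 : m - a = (b - a) / 2 by rewrite /m; lra.
have m2 : b - m = (b - a) / 2 by rewrite /m; lra.
have n1 : n - c = (d - c) / 2 by rewrite /n; lra.
have n2 : d - n = (d - c) / 2 by rewrite /n; lra.
have E : rect_int f a b c d = rect_int f a m c n + rect_int f a m n d +
    (rect_int f m b c n + rect_int f m b n d).
  by rewrite (rect_int_hsplit c d cf am mb) (rect_int_vsplit a m cf cn nd)
    (rect_int_vsplit m b cf cn nd).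
pose r := `|rect_int f a b c d|.
have : r <= `|rect_int f a m c n| + `|rect_int f a m n d| +
    (`|rect_int f m b c n| + `|rect_int f m b n d|).
  rewrite /r E; apply: le_trans (ler_normD _ _) _.
  by apply: lerD; exact: ler_normD.
have [?|?] := leP r (4 * `|rect_int f a m c n|).
  move=> _; exists (a, m, (c, n)) => /=; split; rewrite ?lexx ?am ?mb ?cn ?nd //; by split.
have [?|?] := leP r (4 * `|rect_int f a m n d|).
  move=> _; exists (a, m, (n, d)) => /=; split; rewrite ?lexx ?am ?mb ?cn ?nd //; by split.
have [?|?] := leP r (4 * `|rect_int f m b c n|).
  move=> _; exists (m, b, (c, n)) => /=; split; rewrite ?lexx ?am ?mb ?cn ?nd //; by split.
have [?|?] := leP r (4 * `|rect_int f m b n d|).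
  move=> _; exists (m, b, (n, d)) => /=; split; rewrite ?lexx ?am ?mb ?cn ?nd //; by split.
lra.
Qed.

(** The chosen quarters shrink to a point, near which [f] is affine up to a small multiple of the
    distance. Affine parts integrate to zero, and perimeter times diameter decreases like [4^-k],
    which compensates the factor [4^k] from the bisection. *)
Lemma rect_int_closed f a b c d : continuous f -> a <= b -> c <= d ->
  (forall z : C, a <= Re z <= b -> c <= Im z <= d -> @derivable C C^o C^o f z 1) ->
  rect_int f a b c d = 0.
Proof.
move=> cf ab cd df.
pose good q := left q <= right q /\ bottom q <= top q.
(* The guard [good q] makes the statement true for every tuple, so that choice yields a total
   function to iterate. *)
have /choice[next nextP] : forall q, exists q', good q ->
    [/\ left q <= left q' <= right q' /\ right q' <= right q,
    bottom q <= bottom q' <= top q' /\ top q' <= top q,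
    right q' - left q' = (right q - left q) / 2,
    top q' - bottom q' = (top q - bottom q) / 2 &
    `|rint f q| <= 4 * `|rint f q'|].
  move=> q; have [[g1 g2]|ng] := pselect (good q); last by exists q.
  by have [q' H] := rect_int_quarter cf g1 g2; exists q'.
pose Q k := iter k next ((a, b), (c, d)).
have gQ k : good (Q k).
  elim: k => [//|k IH]; have [[/andP[_ ?] _] [/andP[_ ?] _] _ _ _] := nextP _ IH.
  by split.
have QS k := nextP _ (gQ k).
have [x xP] : exists x, forall k, left (Q k) <= x <= right (Q k).
  apply: sup_nested => k; [| |by case: (gQ k)].
    by case: (QS k) => [[/andP[]]].
  by case: (QS k) => [[_]].
have [y yP] : exists y, forall k, bottom (Q k) <= y <= top (Q k).
  apply: sup_nested => k; [| |by case: (gQ k)].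
    by case: (QS k) => _ [/andP[]].
  by case: (QS k) => _ [_].
pose s : R := (b - a) + (d - c).
have s0 : 0 <= s by rewrite addr_ge0 ?subr_ge0.
have size k : (right (Q k) - left (Q k)) + (top (Q k) - bottom (Q k)) = s / 2 ^+ k.
  elim: k => [|k IH]; first by rewrite expr0 divr1.
  case: (QS k) => _ _; rewrite -/(Q k.+1) => -> -> _.
  by rewrite -mulrDl IH exprS; field; rewrite expf_neq0// pnatr_eq0.
have large k : `|rect_int f a b c d| <= 4 ^+ k * `|rint f (Q k)|.
  elim: k => [|k IH]; first by rewrite expr0 mul1r.
  apply: (le_trans IH); rewrite exprSr -mulrA ler_wpM2l ?exprn_ge0//.
  by case: (QS k).
have HD := derivable_cabsP (df (x +i* y) (xP 0%N) (yP 0%N)).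
pose D : C := 'D_1 f (x +i* y : C).
apply/eqP; rewrite -normr_le0; apply/ler_addgt0Pl => e e0; rewrite addr0.
(* The final estimate is [2 * e' * s^2], independent of [k]; the [+ 1] keeps the denominator
   positive for a degenerate rectangle. *)
pose e' := e / (2 * s ^+ 2 + 1).
have s2 : 0 < 2 * s ^+ 2 + 1 by rewrite ltr_wpDl// mulr_ge0// sqr_ge0.
have e'0 : 0 < e' by rewrite divr_gt0.
have {HD}[r r0 HD] := HD _ e'0.
have [k sk] : exists k, s / 2 ^+ k < r.
  exists (Num.bound (s / r)); rewrite ltr_pdivrMr ?exprn_gt0// -ltr_pdivrMl//.
  rewrite mulrC; apply: le_lt_trans (ler_norm _) _.
  apply: lt_trans (archi_boundP (normr_ge0 _)) _.
  rewrite ger0_norm; last by rewrite divr_ge0// ltW.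
  by rewrite -natrX ltr_nat ltn_expl.
apply: le_trans (large k) _.
have -> : rint f (Q k) = rint (fun z => f z - (f (x +i* y) + D * (z - (x +i* y)))) (Q k).
  have [g1 g2] := gQ k.
  rewrite {2}/rint (rect_intB _ _ _ _ cf (@continuous_affine _ _ _)).
  by rewrite (rect_int_affine _ _ _ g1 g2) subr0.
have near z : left (Q k) <= Re z <= right (Q k) -> bottom (Q k) <= Im z <= top (Q k) ->
    cabs (z - (x +i* y)) <= s / 2 ^+ k.
  move=> hx hy; apply: le_trans (cabs_ReIm _) _; rewrite -size RecB ImcB /=.
  move: hx hy (xP k) (yP k) => /andP[? ?] /andP[? ?] /andP[? ?] /andP[? ?].
  by apply: lerD; rewrite ler_norml; apply/andP; split; lra.
have cg : continuous (fun z : C => f z - (f (x +i* y) + D * (z - (x +i* y)))).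
  by move=> z; exact: (cvgB (cf z) (@continuous_affine _ _ _ z)).
case: (gQ k) => g1 g2.
have /(_ (e' * (s / 2 ^+ k))) := @rect_int_bound R _ _ _ _ _ _ cg g1 g2.
rewrite size => H.
apply: (@le_trans _ _ (4 ^+ k * (2 * (e' * (s / 2 ^+ k)) * (s / 2 ^+ k)))).
  rewrite ler_wpM2l ?exprn_ge0//; apply: H => z hx hy.
  rewrite opprD addrA; apply: le_trans (HD z _) _.
    exact: le_lt_trans (near _ hx hy) sk.
  by rewrite ler_wpM2l ?near// ltW.
have -> : 4 ^+ k * (2 * (e' * (s / 2 ^+ k)) * (s / 2 ^+ k)) = 2 * e' * s ^+ 2 :> R.
  have -> : 4 = 2 * 2 :> R by rewrite -natrM.
  by rewrite exprMn; field; rewrite expf_neq0// pnatr_eq0.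
have E2 : e' * (2 * s ^+ 2 + 1) = e by rewrite divfK ?lt0r_neq0.
by rewrite -E2 mulrDr mulr1 [2 * e']mulrC -mulrA lerDl ltW.
Qed.

End Goursat.

(** * Goursat's theorem with exceptional horizontal lines *)

Section GoursatLines.
Variable R : realType.
Local Notation C := (R[i] : numFieldType).
Local Notation Re := (@complex.Re R).
Local Notation Im := (@complex.Im R).
Implicit Types (f g : C -> C) (a b c d : R).

(** When both horizontal sides are near height [s], their contributions almost cancel by continuity
    of the integral in the height, and the vertical sides are short. Each of the four errors gets
    [e / 4]. *)
Lemma rect_int_thin f a b (s e : R) : continuous f -> 0 < e ->
  exists2 r : R, 0 < r & forall c d, c <= d -> `|c - s| < r -> `|d - s| < r ->
    `|rect_int f a b c d| <= e.
Proof.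
move=> cf e0.
have cu : continuous (fun p : R * R => Re (f (p.2 +i* p.1))).
  have sw : continuous (fun p : R * R => (p.2, p.1)).
    move=> [x y]; apply: (@cvg_pair _ _ _ (nbhs (x, y)) (nbhs y) (nbhs x) _ _ _ snd fst).
      exact: cvg_snd.
    exact: cvg_fst.
  move=> p; have h := cvg_comp _ _ (sw p) (@continuous_Complex R _).
  have h' := cvg_comp _ _ h (cf _).
  exact: (cvg_comp _ _ h' (@continuous_Re R _)).
have ch := @sint_continuous R (fun t x => Re (f (x +i* t))) a b cu.
have e4 : 0 < e / 4 by rewrite divr_gt0.
have := ch s; move/(@cvgrPdist_le _ _ _ _ (nbhs_filter s))/(_ _ e4)/nbhs_normP => [r1 /= r10 H1].
have vert (k : R) : exists2 r : R, 0 < r & forall c d, c <= d -> `|c - s| < r -> `|d - s| < r ->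
    `|sint (fun y => Im (f (k +i* y))) c d| <= e / 4.
  have cv := @continuous_Im_vert R f k cf.
  have := cv s; move/(@cvgrPdist_le _ _ _ _ (nbhs_filter s))/(_ _ ltr01)/nbhs_normP => [r2 /= r20 H2].
  pose M := `|Im (f (k +i* s))| + 1.
  have M0 : 0 < M by rewrite ltr_wpDl.
  (* Both ends lie within this radius of [s], so [d - c] is at most twice it and [M * (d - c)] at
     most [e / 4]; [M] bounds the integrand within [r2] of [s]. *)
  exists (Num.min r2 (e / 4 / (2 * M))).
    by rewrite lt_min r20/= divr_gt0// mulr_gt0.
  move=> c d cd; rewrite !lt_min => /andP[cr ce] /andP[dr de].
  apply: (@le_trans _ _ (M * (d - c))).
    apply: sint_bound => // y /andP[cy yd].
    have : `|Im (f (k +i* s)) - Im (f (k +i* y))| <= 1.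
      apply: H2 => /=; move: cr dr; rewrite !ltr_norml => /andP[? ?] /andP[? ?].
      by apply/andP; split; lra.
    move=> hy; rewrite -[Im (f (k +i* y))](subrK (Im (f (k +i* s)))).
    by rewrite (le_trans (ler_normD _ _))// addrC /M lerD2l distrC.
  have : d - c <= 2 * (e / 4 / (2 * M)).
    move: ce de; rewrite !ltr_norml => /andP[? ?] /andP[? ?]; lra.
  move=> dc; apply: (@le_trans _ _ (M * (2 * (e / 4 / (2 * M))))).
    by rewrite ler_pM2l.
  have -> : M * (2 * (e / 4 / (2 * M))) = e / 4 by field; rewrite lt0r_neq0.
  by [].
have [r2 r20 H2] := vert a; have [r3 r30 H3] := vert b.
exists (Num.min r1 (Num.min r2 r3)); first by rewrite !lt_min r10 r20 r30.
move=> c d cd; rewrite !lt_min => /andP[c1 /andP[c2 c3]] /andP[d1 /andP[d2 d3]].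
have := H2 _ _ cd c2 d2; have := H3 _ _ cd c3 d3.
have := H1 c; have := H1 d; rewrite /= !(distrC s) => /(_ d1) + /(_ c1).
rewrite /rect_int !ler_norml => /andP[? ?] /andP[? ?] /andP[? ?] /andP[? ?].
by apply/andP; split; lra.
Qed.

(** Thin rectangles along the two horizontal sides are cut off and contribute arbitrarily little;
    the rest is covered by the closed case. *)
Lemma rect_int_strip f a b c d : continuous f -> a <= b -> c <= d ->
  (forall z : C, c < Im z < d -> @derivable C C^o C^o f z 1) ->
  rect_int f a b c d = 0.
Proof.
move=> cf ab cd df; apply/eqP; rewrite -normr_le0; apply/ler_addgt0Pl => e e0.
rewrite addr0; have e2 : 0 < e / 2 by rewrite divr_gt0.
have [r r0 Hr] := rect_int_thin a b c cf e2.
have [s s0 Hs] := rect_int_thin a b d cf e2.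
move: cd; rewrite le_eqVlt => /predU1P[<-|cd].
  by apply: le_trans (Hr c c _ _ _) _; rewrite ?subrr ?normr0// ler_pdivrMr// ler_peMr ?ltW// ltr1n.
(* The halves keep the cut strictly inside both radii of thinness, and the third leaves a genuine
   middle rectangle. *)
pose t := Num.min (Num.min r s / 2) ((d - c) / 3).
have t0 : 0 < t by rewrite lt_min !divr_gt0 ?subr_gt0 ?lt_min ?r0.
have : t <= Num.min r s / 2 by rewrite ge_min lexx.
rewrite ler_pdivlMr// le_min => /andP[tr ts].
have td : t <= (d - c) / 3 by rewrite ge_min lexx orbT.
have h1 : c <= c + t by lra.
have h2 : c + t <= d - t by lra.
have h3 : d - t <= d by lra.
rewrite (rect_int_vsplit a b cf h1 (le_trans h2 h3)) (rect_int_vsplit a b cf h2 h3).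
rewrite (rect_int_closed cf ab h2) ?add0r; last first.
  by move=> z _ /andP[? ?]; apply: df; apply/andP; split; lra.
rewrite (le_trans (ler_normD _ _))// [leRHS]splitr lerD//.
  by apply: Hr; rewrite ?subrr ?normr0// addrAC subrr add0r ger0_norm; lra.
by apply: Hs; rewrite ?subrr ?normr0// addrAC subrr add0r normrN ger0_norm; lra.
Qed.

(** Cutting along an exceptional line turns it into a side of the two pieces, and on horizontal
    sides continuity suffices. *)
Lemma rect_int_lines f (S : seq R) a b c d : continuous f -> a <= b -> c <= d ->
  (forall z : C, c < Im z < d -> Im z \notin S -> @derivable C C^o C^o f z 1) ->
  rect_int f a b c d = 0.
Proof.
move=> cf ab; elim: S c d => [|s S IH] c d cd df.
  by apply: rect_int_strip => // z hz; exact: df.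
have [/andP[cs sd]|ncd] := boolP (c < s < d).
  rewrite (rect_int_vsplit a b cf (ltW cs) (ltW sd)) !IH ?addr0 ?(ltW cs) ?(ltW sd)//.
    move=> z /andP[sz zd] zS; apply: df; first by rewrite zd (lt_trans cs).
    by rewrite inE negb_or zS andbT gt_eqF.
  move=> z /andP[sz zd] zS; apply: df; first by rewrite sz (lt_trans zd).
  by rewrite inE negb_or zS andbT lt_eqF.
apply: IH => // z hz zS; apply: df => //; rewrite inE negb_or zS andbT.
by apply: contraNneq ncd => <-.
Qed.

End GoursatLines.

(** * Continuous extension from a half-plane *)

Section BoundaryExtension.
Variable R : realType.
Local Notation C := (R[i] : numFieldType).
Local Notation Re := (@complex.Re R).
Local Notation Im := (@complex.Im R).
Local Notation upper := (@upper_half_plane R).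
Local Notation lower := (@lower_half_plane R).
Implicit Types (f g : C -> C) (H : set C).

Definition half_plane H := H = upper \/ H = lower.

Definition bfilter H (x : R) : set_system C := within H (nbhs (x%:C : C)).

Definition bvalue H f (x : R) : C := lim (f w @[w --> bfilter H x]).

(** Outside [H] the boundary value is continued constantly along vertical lines. The result is
    continuous on the whole plane, as the integration lemmas ask, although only its values on the
    closure of [H] are of interest. *)
Definition bext H f (z : C) : C :=
  if `[< H z >] then f z else bvalue H f (Re z).

Lemma bextE H f z : H z -> bext H f z = f z.
Proof. by move=> Hz; rewrite /bext asboolT. Qed.

Lemma bext_out H f z : ~ H z -> bext H f z = bvalue H f (Re z).
Proof. by move=> Hz; rewrite /bext asboolF. Qed.

#[global] Instance bfilter_filter H x : Filter (bfilter H x).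
Proof. exact: within_filter. Qed.

Lemma bfilterP H x (P : set C) : bfilter H x P <->
  exists2 d : R, 0 < d & forall w, H w -> cabs (w - x%:C) < d -> P w.
Proof.
rewrite /bfilter /within /=; split.
  by move=> /nbhs_cabsP[d d0 h]; exists d => // w Hw wd; exact: h.
by move=> [d d0 h]; apply/nbhs_cabsP; exists d => // w wd Hw; exact: h.
Qed.

Lemma half_plane_approx H (x d : R) : half_plane H -> 0 < d ->
  exists2 w : C, H w & cabs (w - x%:C) < d.
Proof.
move=> hH d0.
have d2 : 0 < d / 2 by rewrite divr_gt0.
have lt : `|d / 2| < d by rewrite gtr0_norm// ltr_pdivrMr// ltr_pMr// ltr1n.
case: hH => ->; [exists (x +i* (d / 2)) | exists (x +i* (- (d / 2)))].
- by rewrite /upper_half_plane /=.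
- apply: le_lt_trans (cabs_ReIm _) _; rewrite RecB ImcB /= subrr normr0 add0r subr0.
  by [].
- by rewrite /lower_half_plane /= oppr_lt0.
- apply: le_lt_trans (cabs_ReIm _) _; rewrite RecB ImcB /= subrr normr0 add0r subr0.
  by rewrite normrN.
Qed.

Lemma bfilter_proper H x : half_plane H -> ProperFilter (bfilter H x).
Proof.
move=> hH; apply: Build_ProperFilter_ex => P /bfilterP[d d0 h].
by have [w Hw wd] := half_plane_approx x hH d0; exists w; exact: h.
Qed.

Lemma bvalue_lim H f x l : half_plane H -> f w @[w --> bfilter H x] --> l ->
  bvalue H f x = l.
Proof. by move=> /(bfilter_proper x) hP fl; apply: cvg_lim. Qed.

Lemma half_plane_open H z : half_plane H -> H z -> nbhs (z : C) H.
Proof.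
move=> hH Hz; apply/nbhs_cabsP; exists `|Im z|.
  by rewrite normr_gt0; case: hH Hz => ->; rewrite /= => h; rewrite (gt_eqF h, lt_eqF h).
move=> w; move=> /(le_lt_trans (cabs_Im _)); rewrite ImcB.
case: hH Hz => -> /= h.
  by rewrite (gtr0_norm h) ltr_norml => /andP[? ?]; rewrite /upper_half_plane /=; lra.
by rewrite (ltr0_norm h) ltr_norml => /andP[? ?]; rewrite /lower_half_plane /=; lra.
Qed.

(** The points lie on opposite sides of the axis (or [z] on it), so moving [z] vertically to the
    axis shortens the vertical distance to [w]. *)
Lemma half_plane_closer H (w z : C) : half_plane H -> H w -> ~ H z ->
  cabs (w - (Re z)%:C) <= cabs (w - z).
Proof.
move=> hH Hw Hz; rewrite /cabs !normc_def /= ler_wsqrtr// !RecB !ImcB /= lerD2l subr0.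
rewrite -[leLHS](real_normK (num_real _)) -[leRHS](real_normK (num_real _)) ler_sqr ?nnegrE//.
case: hH Hw Hz => -> /=; rewrite /upper_half_plane /lower_half_plane /= => h /negP; rewrite -leNgt => h'.
  by rewrite !ger0_norm; lra.
by rewrite !ler0_norm; lra.
Qed.

(** The limits are unrestricted within [H], and this forces the boundary function itself to be
    continuous along the real line. *)
Lemma continuous_bext H f : half_plane H ->
  (forall z, H z -> {for z, continuous f}) ->
  (forall x, cvg (f w @[w --> bfilter H x])) -> continuous (bext H f).
Proof.
move=> hH cf bf z.
have lim x e : 0 < e -> exists2 d : R, 0 < d &
    forall w, H w -> cabs (w - x%:C) < d -> cabs (f w - bvalue H f x) <= e.
  move=> e0; have /cvg_cabsP/(_ e e0)/bfilterP := bf x.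
  by move=> [d d0 h]; exists d.
have [Hz|nHz] := pselect (H z).
  have fz : f w @[w --> z] --> bext H f z.
    by rewrite bextE//; exact: cf.
  have nf : \forall w \near z, f w = bext H f w.
    by apply: filterS (half_plane_open hH Hz) => w Hw; rewrite bextE.
  exact: cvg_trans (near_eq_cvg nf) fz.
have ez : bext H f z = bvalue H f (Re z) by rewrite bext_out.
apply/(@cvg_cabsP R _ _ (nbhs_filter z)) => e e0; have e2 : 0 < e / 2 by rewrite divr_gt0.
have [d d0 h] := lim (Re z) _ e2.
apply/nbhs_cabsP; exists d => // w wd; rewrite ez; have [Hw|nHw] := pselect (H w).
  rewrite bextE//; apply: le_trans (h w Hw (le_lt_trans (half_plane_closer hH Hw nHz) wd)) _.
  by rewrite ler_pdivrMr// ler_peMr ?ltW// ltr1n.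
(* Two boundary values are compared through a point [v] of [H], chosen so close to [Re w] that it is
   also within the range [d] of the limit at [Re z]. *)
rewrite bext_out//; have [d' d'0 h'] := lim (Re w) _ e2.
have wz : cabs ((Re w)%:C - (Re z)%:C) < d.
  by rewrite -rmorphB cabs_real -RecB (le_lt_trans (cabs_Re _)).
have [v Hv] := @half_plane_approx H (Re w) (Num.min d' (d - cabs ((Re w)%:C - (Re z)%:C))) hH
  ltac:(by rewrite lt_min d'0 subr_gt0).
rewrite lt_min ltrBrDr => /andP[vw vz].
have := h' v Hv vw; have : cabs (f v - bvalue H f (Re z)) <= e / 2.
  apply: h => //; apply: le_lt_trans vz.
  by rewrite -[v - _](subrKA ((Re w)%:C)) cabsD.
move=> h1 h2; rewrite -(subrKA (f v)) [leRHS]splitr.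
by apply: le_trans (cabsD _ _) (lerD _ h1); rewrite cabs_distr.
Qed.

End BoundaryExtension.

(** * The class of functions analytic off the real axis with boundary values *)

Section SectionallyAnalytic.
Variable R : realType.
Local Notation C := (R[i] : numFieldType).
Local Notation Re := (@complex.Re R).
Local Notation Im := (@complex.Im R).
Local Notation upper := (@upper_half_plane R).
Local Notation lower := (@lower_half_plane R).
Implicit Types (f g : C -> C) (H : set C) (S : seq R).

(* On the horizontal lines at the heights in [S] only continuity is required: the
   difference quotient of [f] at a point [a] belongs to the class with [Im a]
   added to [S], and no removable singularity theorem is needed. *)
Definition sectionally_analytic S f : Prop :=
  [/\ forall z : C, Im z != 0 -> Im z \notin S -> @derivable C C^o C^o f z 1,
      forall z : C, Im z != 0 -> {for z, continuous f} &
      forall H x, half_plane H -> cvg (f w @[w --> bfilter H x])].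

Local Notation sana := sectionally_analytic.

Lemma bvalue_cvg S f H x : sana S f -> half_plane H ->
  f w @[w --> bfilter H x] --> bvalue H f x.
Proof. by move=> [_ _ h] hH; exact: h. Qed.

Lemma cvg_bfilter_id H (x : R) : w @[w --> bfilter H x] --> (x%:C : C).
Proof. by move=> P /= nP; exact: cvg_within. Qed.

Lemma sana_cst S (k : C) : sana S (fun=> k).
Proof.
split.
- by move=> z _ _; exact: (@derivable_cst C C^o C^o k z 1).
- by move=> z _; exact: (@cst_continuous C C k z).
- by move=> H x _; apply: is_cvg_cst.
Qed.

Lemma sana_id S : sana S id.
Proof.
split.
- by move=> z _ _; exact: (@derivable_id C C^o z 1).
- by move=> z _; exact: cvg_id.
- by move=> H x _; apply/cvg_ex; exists x%:C; exact: cvg_bfilter_id.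
Qed.

Lemma sanaD S f g : sana S f -> sana S g -> sana S (fun z => f z + g z).
Proof.
move=> [df cf bf] [dg cg bg]; split.
- by move=> z z0 zS; exact: (derivableD (df z z0 zS) (dg z z0 zS)).
- by move=> z z0; exact: (cvgD (cf z z0) (cg z z0)).
- by move=> H x hH; exact: (is_cvgD (bf H x hH) (bg H x hH)).
Qed.

Lemma sanaM S f g : sana S f -> sana S g -> sana S (fun z => f z * g z).
Proof.
move=> [df cf bf] [dg cg bg]; split.
- by move=> z z0 zS; exact: (derivableM (df z z0 zS) (dg z z0 zS)).
- by move=> z z0; exact: (cvgM (cf z z0) (cg z z0)).
- by move=> H x hH; exact: (is_cvgM (bf H x hH) (bg H x hH)).
Qed.

Lemma bvalue_cst H x (k : C) : half_plane H -> bvalue H (fun=> k) x = k.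
Proof. by move=> hH; apply: bvalue_lim => //; exact: cvg_cst. Qed.

Lemma bvalue_id H x : half_plane H -> bvalue H id x = x%:C.
Proof. by move=> hH; apply: bvalue_lim => //; exact: cvg_bfilter_id. Qed.

Lemma bvalueD S f g H x : sana S f -> sana S g -> half_plane H ->
  bvalue H (fun z => f z + g z) x = bvalue H f x + bvalue H g x.
Proof.
move=> sf sg hH; apply: bvalue_lim => //.
exact: (cvgD (bvalue_cvg sf hH) (bvalue_cvg sg hH)).
Qed.

Lemma bvalueM S f g H x : sana S f -> sana S g -> half_plane H ->
  bvalue H (fun z => f z * g z) x = bvalue H f x * bvalue H g x.
Proof.
move=> sf sg hH; apply: bvalue_lim => //.
exact: (cvgM (bvalue_cvg sf hH) (bvalue_cvg sg hH)).
Qed.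

Lemma sana_sum S (I : Type) (r : seq I) (P : pred I) (F : I -> C -> C) :
  (forall i, sana S (F i)) -> sana S (fun z => \sum_(i <- r | P i) F i z).
Proof.
move=> sF; elim: r => [|i r IH].
  by under eq_fun do rewrite big_nil; exact: sana_cst.
under eq_fun do rewrite big_cons; case: (P i); [exact: (sanaD (sF i) IH) | exact: IH].
Qed.

Lemma sana_prod S (I : Type) (r : seq I) (P : pred I) (F : I -> C -> C) :
  (forall i, sana S (F i)) -> sana S (fun z => \prod_(i <- r | P i) F i z).
Proof.
move=> sF; elim: r => [|i r IH].
  by under eq_fun do rewrite big_nil; exact: sana_cst.
under eq_fun do rewrite big_cons; case: (P i); [exact: (sanaM (sF i) IH) | exact: IH].
Qed.

Lemma bvalue_sum S (I : Type) (r : seq I) (P : pred I) (F : I -> C -> C) H x :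
  (forall i, sana S (F i)) -> half_plane H ->
  bvalue H (fun z => \sum_(i <- r | P i) F i z) x = \sum_(i <- r | P i) bvalue H (F i) x.
Proof.
move=> sF hH; elim: r => [|i r IH].
  by rewrite big_nil; under eq_fun do rewrite big_nil; exact: bvalue_cst.
rewrite big_cons; under eq_fun do rewrite big_cons; case: (P i); last exact: IH.
by rewrite (bvalueD _ (sF i) (sana_sum _ _ sF) hH) IH.
Qed.

Lemma bvalue_prod S (I : Type) (r : seq I) (P : pred I) (F : I -> C -> C) H x :
  (forall i, sana S (F i)) -> half_plane H ->
  bvalue H (fun z => \prod_(i <- r | P i) F i z) x = \prod_(i <- r | P i) bvalue H (F i) x.
Proof.
move=> sF hH; elim: r => [|i r IH].
  by rewrite big_nil; under eq_fun do rewrite big_nil; exact: bvalue_cst.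
rewrite big_cons; under eq_fun do rewrite big_cons; case: (P i); last exact: IH.
by rewrite (bvalueM _ (sF i) (sana_prod _ _ sF) hH) IH.
Qed.

Lemma sana_horner S (p : {poly R[i]}) : sana S (fun z => p.[z]).
Proof.
elim/poly_ind: p => [|p c IH].
  by under eq_fun do rewrite horner0; exact: sana_cst.
under eq_fun do rewrite hornerMXaddC.
exact: sanaD (sanaM IH (sana_id _)) (sana_cst _ _).
Qed.

Lemma bvalue_horner (p : {poly R[i]}) H x : half_plane H ->
  bvalue H (fun z => p.[z]) x = p.[x%:C].
Proof.
move=> hH; elim/poly_ind: p => [|p c IH].
  by under eq_fun do rewrite horner0; rewrite bvalue_cst// horner0.
under eq_fun do rewrite hornerMXaddC.
have sp := sana_horner [::] p; have si := sana_id [::].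
rewrite (bvalueD _ (sanaM sp si) (sana_cst _ _) hH) (bvalueM _ sp si hH).
by rewrite IH (bvalue_id _ hH) (bvalue_cst _ _ hH) hornerMXaddC.
Qed.

Definition quot f (a z : C) : C :=
  if z == a then 'D_1 f a else (f z - f a) / (z - a).

Lemma quotE f a z : z != a -> quot f a z = (f z - f a) / (z - a).
Proof. by rewrite /quot => /negbTE ->. Qed.

Lemma near_neq (a z : C) : z != a -> \forall w \near z, w != a.
Proof.
move=> za; apply/nbhs_cabsP; exists (cabs (z - a)); first by rewrite cabs_gt0 subr_eq0.
by move=> w; apply: contraTneq => ->; rewrite cabs_distr ltxx.
Qed.

Lemma bfilter_neq H (a : C) (x : R) : Im a != 0 -> \forall w \near bfilter H x, w != a.
Proof.
move=> a0; apply: cvg_within; apply: near_neq.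
by apply: contra_neq a0 => <-.
Qed.

Lemma cvg_quot f (a z l : C) (F : set_system C) {FF : Filter F} :
  z != a -> (\forall w \near F, w != a) -> w @[w --> F] --> z -> f w @[w --> F] --> l ->
  quot f a w @[w --> F] --> (l - f a) / (z - a).
Proof.
move=> za nF wF fF.
have nq : \forall w \near F, (f w - f a) / (w - a) = quot f a w.
  by apply: filterS nF => w wa; rewrite quotE.
apply: cvg_trans (near_eq_cvg nq) _.
apply: (cvgM (cvgB fF (cvg_cst (f a)))).
apply: cvgV; first by rewrite subr_eq0.
exact: (cvgB wF (cvg_cst a)).
Qed.

(** At [a] only continuity is left to check, and it is the definition of the derivative. The
    boundary values survive because [a] is not real. *)
Lemma sana_quot S f (a : C) : sana S f -> Im a != 0 -> Im a \notin S ->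
  sana (Im a :: S) (quot f a).
Proof.
move=> [df cf bf] a0 aS; split.
- move=> z z0; rewrite inE negb_or => /andP[za zS].
  have {}za : z != a by apply: contra_neq za => ->.
  have dq : @derivable C C^o C^o (fun w => (f w - f a) / (w - a)) z 1.
    apply: (@derivableM C C^o (fun w => f w - f a) (fun w => (w - a)^-1)).
      apply: (@derivableB C C^o C^o f (fun=> f a)); first exact: df.
      exact: derivable_cst.
    apply: (@derivableV C C^o (fun w => w - a)); first by rewrite subr_eq0.
    apply: (@derivableB C C^o C^o id (fun=> a)); first exact: derivable_id.
    exact: derivable_cst.
  have nq : \forall w \near z, (f w - f a) / (w - a) = quot f a w.
    by apply: filterS (near_neq za) => w wa; rewrite quotE.
  exact: (@near_eq_derivable C C^o C^o _ _ z 1 nq dq).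
- move=> z z0; have [->|za] := eqVneq z a; last first.
    rewrite /prop_for /continuous_at (quotE f za).
    exact: (cvg_quot za (near_neq za) cvg_id (cf z z0)).
  apply/(@cvg_cabsP R _ _ (nbhs_filter a)) => e e0.
  have [d d0 h] := derivable_cabsP (df a a0 aS) e0.
  apply/nbhs_cabsP; exists d => // w wd; have [->|wa] := eqVneq w a.
    by rewrite subrr cabs0 ltW.
  have wa0 : w - a != 0 by rewrite subr_eq0.
  rewrite quotE// /quot eqxx -(ler_pM2r (x := cabs (w - a))) ?cabs_gt0//.
  by rewrite -cabsM mulrBl divfK// h.
- move=> H x hH; apply/cvg_ex; exists ((bvalue H f x - f a) / (x%:C - a)).
  apply: cvg_quot; [|exact: bfilter_neq|exact: cvg_bfilter_id|exact: bf].
  by apply: contra_neq a0 => <-.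
Qed.

Lemma bvalue_quot S f (a : C) H x : sana S f -> Im a != 0 -> half_plane H ->
  bvalue H (quot f a) x = (bvalue H f x - f a) / (x%:C - a).
Proof.
move=> sf a0 hH; apply: bvalue_lim => //.
apply: cvg_quot; [|exact: bfilter_neq|exact: cvg_bfilter_id|exact: bvalue_cvg sf hH].
by apply: contra_neq a0 => <-.
Qed.

Lemma sana_continuous_bext S f H : sana S f -> half_plane H -> continuous (bext H f).
Proof.
move=> [_ cf bf] hH; apply: continuous_bext => // [z Hz|x]; last exact: bf.
apply: cf; case: hH Hz => -> Hz; first by rewrite gt_eqF.
by rewrite lt_eqF.
Qed.

Lemma sana_derivable_bext S f H (z : C) : sana S f -> half_plane H -> H z ->
  Im z != 0 -> Im z \notin S -> @derivable C C^o C^o (bext H f) z 1.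
Proof.
move=> [df _ _] hH Hz z0 zS.
have nb : \forall w \near z, f w = bext H f w.
  by apply: filterS (half_plane_open hH Hz) => w Hw; rewrite bextE.
exact: (@near_eq_derivable C C^o C^o _ _ z 1 nb (df z z0 zS)).
Qed.

Lemma sana_rect_upper S f a b d : sana S f -> a <= b -> 0 <= d ->
  rect_int (bext upper f) a b 0 d = 0.
Proof.
move=> sf ab d0; have hH : half_plane upper by left.
apply: (@rect_int_lines _ _ S) => //; first exact: sana_continuous_bext sf hH.
move=> z /andP[z0 _] zS; apply: (sana_derivable_bext sf) => //.
by rewrite gt_eqF.
Qed.

Lemma sana_rect_lower S f a b c : sana S f -> a <= b -> c <= 0 ->
  rect_int (bext lower f) a b c 0 = 0.
Proof.
move=> sf ab d0; have hH : half_plane lower by right.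
apply: (@rect_int_lines _ _ S) => //; first exact: sana_continuous_bext sf hH.
move=> z /andP[_ z0] zS; apply: (sana_derivable_bext sf) => //.
by rewrite lt_eqF.
Qed.

End SectionallyAnalytic.

(** * Cauchy's formula for a function with a jump across the real axis *)

Section Cauchy.
Variable R : realType.
Local Notation C := (R[i] : numFieldType).
Local Notation Re := (@complex.Re R).
Local Notation Im := (@complex.Im R).
Local Notation upper := (@upper_half_plane R).
Local Notation lower := (@lower_half_plane R).
Implicit Types (f g : C -> C) (H : set C) (S : seq R).
Local Notation sana := sectionally_analytic.

Lemma Re_div (k w : R[i]) :
  Re (k / w) = (Re k * Re w + Im k * Im w) / (Re w ^+ 2 + Im w ^+ 2).
Proof. by case: k => a b; case: w => c d /=; ring. Qed.

Lemma Im_div (k w : R[i]) :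
  Im (k / w) = (Im k * Re w - Re k * Im w) / (Re w ^+ 2 + Im w ^+ 2).
Proof. by case: k => a b; case: w => c d /=; ring. Qed.

(** The integrand has primitive [2 k atan((x - x0) / L)], whose argument runs from [-1] to [1]. This
    is the share of one pair of opposite sides of a square in the integral of [dz / (z - a)]. *)
Lemma sint_poisson (k x0 L : R) : 0 < L ->
  sint (fun x => 2 * k * L / ((x - x0) ^+ 2 + L ^+ 2)) (x0 - L) (x0 + L) = pi * k.
Proof.
move=> L0; have L2 x : (x - x0) ^+ 2 + L ^+ 2 != 0.
  by rewrite lt0r_neq0// ltr_wpDl ?sqr_ge0// exprn_gt0.
have dF (x : R) : is_derive x 1 (fun x : R => 2 * k * atan ((x - x0) / L))
    (2 * k * L / ((x - x0) ^+ 2 + L ^+ 2)).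
  apply: is_derive_eq; rewrite /GRing.scale /= mulr0 add0r subr0 mulr1.
  have -> : 1 + ((x - x0) / L) ^+ 2 = ((x - x0) ^+ 2 + L ^+ 2) / L ^+ 2.
    by field; rewrite lt0r_neq0.
  by field; rewrite L2 lt0r_neq0.
have cF : continuous (fun x : R => 2 * k * L / ((x - x0) ^+ 2 + L ^+ 2)).
  move=> x; apply: cvgM; first exact: cvg_cst.
  apply: cvgV => //; apply: cvgD; last exact: cvg_cst.
  by apply: cvgM; (apply: cvgB; [exact: cvg_id | exact: cvg_cst]).
rewrite (sint_FTC cF dF); last by lra.
have -> : (x0 + L - x0) / L = 1 by field; rewrite lt0r_neq0.
have -> : (x0 - L - x0) / L = - 1 by field; rewrite lt0r_neq0.
by rewrite atanN atan1; field.
Qed.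

Lemma quot_decay f (a z : C) (c M L : R) :
  (forall z, Im z != 0 -> M <= cabs z -> cabs (f z) * cabs z <= c) ->
  0 < L -> 2 * cabs a <= L -> 2 * M <= L -> Im z != 0 -> L <= cabs (z - a) ->
  cabs (quot f a z + f a / (z - a)) <= 2 * c / L ^+ 2.
Proof.
move=> fd L0 La LM z0 zL.
have za : z - a != 0 by rewrite -cabs_gt0 (lt_le_trans L0).
have -> : quot f a z + f a / (z - a) = f z / (z - a).
  have za' : z != a by rewrite -subr_eq0.
  by rewrite (quotE _ za') mulrBl subrK.
have zL2 : L <= 2 * cabs z by have := cabsB z a; lra.
have := fd z z0; rewrite cabsM cabsV => /(_ ltac:(lra)) fz.
have z0' : 0 < cabs z by lra.
have f0 := cabs_ge0 (f z).
rewrite ler_pdivrMr ?(lt_le_trans L0)//.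
have h : cabs (f z) * L <= 2 * c.
  apply: (@le_trans _ _ (cabs (f z) * (2 * cabs z))); first by rewrite ler_wpM2l.
  by rewrite mulrCA ler_pM2l.
have c0 : 0 <= 2 * c by apply: le_trans h; rewrite mulr_ge0// ltW.
apply: (@le_trans _ _ (2 * c / L)); first by rewrite ler_pdivlMr.
have -> : 2 * c / L = 2 * c / L ^+ 2 * L by field; rewrite lt0r_neq0.
by rewrite ler_wpM2l// divr_ge0// sqr_ge0.
Qed.

Lemma continuous_divB (k a : C) (g : R -> C) : continuous g -> (forall t, g t != a) ->
  continuous (fun t : R => k / (g t - a)).
Proof.
move=> cg ga t; apply: (cvgM (cvg_cst k)).
apply: cvgV; first by rewrite subr_eq0.
exact: (cvgB (cg t) (cvg_cst a)).
Qed.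

Lemma continuous_Re_div (k a : C) (T : R) : T != Im a ->
  continuous (fun x : R => Re (k / (x +i* T - a))).
Proof.
move=> Ta; have h : continuous (fun x : R => k / (x +i* T - a)).
  apply: continuous_divB; first exact: continuous_horiz.
  by move=> t; apply: contra_neq Ta => <-.
by move=> x; exact: (cvg_comp _ _ (h x) (@continuous_Re R _)).
Qed.

Lemma continuous_Im_div (k a : C) (X : R) : X != Re a ->
  continuous (fun y : R => Im (k / (X +i* y - a))).
Proof.
move=> Xa; have h : continuous (fun y : R => k / (X +i* y - a)).
  apply: continuous_divB; first exact: continuous_vert.
  by move=> t; apply: contra_neq Xa => <-.
by move=> x; exact: (cvg_comp _ _ (h x) (@continuous_Im R _)).
Qed.

(** A full side has length [2 L], which turns the pointwise error [2 c / L^2] into [4 c / L]. *)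
Lemma horiz_decay S f (a : C) H (c M L T : R) : sana S f ->
  (forall z, Im z != 0 -> M <= cabs z -> cabs (f z) * cabs z <= c) ->
  0 < L -> 2 * cabs a <= L -> 2 * M <= L -> Im a != 0 -> Im a \notin S ->
  half_plane H -> T != 0 -> (forall x, H (x +i* T)) -> `|T - Im a| = L ->
  `|sint (fun x => Re (bext H (quot f a) (x +i* T))) (Re a - L) (Re a + L) +
    sint (fun x => Re (f a / (x +i* T - a))) (Re a - L) (Re a + L)| <= 4 * c / L.
Proof.
move=> sf fd L0 La LM a0 aS hH T0 HT Ta.
have sq := sana_quot sf a0 aS.
have c1 := @continuous_Re_horiz R _ T (sana_continuous_bext sq hH).
have c2 : continuous (fun x : R => Re (f a / (x +i* T - a))).
  by apply: continuous_Re_div; rewrite -subr_eq0 -normr_eq0 Ta lt0r_neq0.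
rewrite -sintD//.
have -> : 4 * c / L = 2 * c / L ^+ 2 * (Re a + L - (Re a - L)).
  by field; rewrite lt0r_neq0.
apply: sint_bound; [|by lra|].
  by move=> x; exact: (cvgD (c1 x) (c2 x)).
move=> x _; rewrite -RecD; apply: le_trans (cabs_Re _) _.
rewrite bextE; last exact: HT.
apply: (quot_decay fd) => //; apply: le_trans (cabs_Im _).
by rewrite ImcB /= Ta.
Qed.

(** The real axis cuts each vertical side into two unequal pieces, hence the general ends [u] and
    [v]. *)
Lemma vert_decay S f (a : C) H (c M L X u v : R) : sana S f ->
  (forall z, Im z != 0 -> M <= cabs z -> cabs (f z) * cabs z <= c) ->
  0 < L -> 2 * cabs a <= L -> 2 * M <= L -> Im a != 0 -> Im a \notin S ->
  half_plane H -> u <= v -> (forall y, u < y < v -> H (X +i* y) /\ y != 0) ->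
  `|X - Re a| = L ->
  `|sint (fun y => Im (bext H (quot f a) (X +i* y))) u v +
    sint (fun y => Im (f a / (X +i* y - a))) u v| <= 2 * c / L ^+ 2 * (v - u).
Proof.
move=> sf fd L0 La LM a0 aS hH uv HT Ta.
have sq := sana_quot sf a0 aS.
have c1 := @continuous_Im_vert R _ X (sana_continuous_bext sq hH).
have c2 : continuous (fun y : R => Im (f a / (X +i* y - a))).
  by apply: continuous_Im_div; rewrite -subr_eq0 -normr_eq0 Ta lt0r_neq0.
rewrite -sintD//; apply: sint_bound => //.
  by move=> x; exact: (cvgD (c1 x) (c2 x)).
move=> y /HT[Hy y0]; rewrite -ImcD; apply: le_trans (cabs_Im _) _.
rewrite bextE//.
apply: (quot_decay fd) => //; apply: le_trans (cabs_Re _).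
by rewrite RecB /= Ta.
Qed.

(** Bookkeeping for the cut square. The letters [g] and [h] stand for integrals of the quotient
    along vertical and horizontal segments, [q] for those of [f a / (z - a)]; [B], [T], [L], [R]
    after them name the side, [0] and [1] the part below or above the axis, [hM] and [hP] the axis
    seen from below and above. The errors add up to [2 (A + B) + 2 D = 4 D]. *)
Let cauchy_jump_arith (qT qB qR0 qR1 qL0 qL1 gL0 gR0 gL1 gR1 hB hT hM hP A B D k : R) :
  qT - qB = pi * k -> A + B = D -> qR0 + qR1 - (qL0 + qL1) = pi * k ->
  `|gL0 + qL0| <= B -> `|gR0 + qR0| <= B -> `|gL1 + qL1| <= A -> `|gR1 + qR1| <= A ->
  `|hB + qB| <= D -> `|hT + qT| <= D ->
  hB - gR0 - hM + gL0 = 0 -> hP - gR1 - hT + gL1 = 0 ->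
  `|hP - hM + 2 * pi * k| <= 4 * D.
Proof.
rewrite !ler_norml => E1 E3 E2.
move=> /andP[? ?] /andP[? ?] /andP[? ?] /andP[? ?] /andP[? ?] /andP[? ?] ? ?.
by apply/andP; split; lra.
Qed.

(* Cauchy's formula for [f], integrated over the boundary of the square of
   half-side [L] centred at [a], cut along the real axis. *)
Lemma cauchy_jump S f (a : C) (c M : R) : sana S f ->
  (forall z, Im z != 0 -> M <= cabs z -> cabs (f z) * cabs z <= c) ->
  Im a != 0 -> Im a \notin S ->
  forall L, 0 < L -> 2 * cabs a <= L -> 2 * M <= L ->
  `|sint (fun x : R => Re ((bvalue upper f x - bvalue lower f x) / (x%:C - a)))
      (Re a - L) (Re a + L) + 2 * pi * Im (f a)| <= 16 * c / L.
Proof.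
move=> sf fd a0 aS L L0 La LM.
have hU : half_plane upper by left.
have hL : half_plane lower by right.
have sq := sana_quot sf a0 aS.
set x0 := Re a; set y0 := Im a; set k := f a.
have aL : `|y0| < L by rewrite (le_lt_trans (cabs_Im _))//; have := cabs_ge0 a; lra.
(* The real axis really crosses the square, so both rectangles have positive height. *)
have [T0 B0] : 0 < y0 + L /\ y0 - L < 0.
  by move: aL; rewrite ltr_norml => /andP[? ?]; split; lra.
pose Gp := bext upper (quot f a); pose Gm := bext lower (quot f a).
have cGp : continuous Gp := sana_continuous_bext sq hU.
have cGm : continuous Gm := sana_continuous_bext sq hL.
have xL : x0 - L <= x0 + L by lra.
have := sana_rect_upper sq xL (ltW T0).
have := sana_rect_lower sq xL (ltW B0).
rewrite /rect_int -/Gp -/Gm.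
have := @horiz_decay S f a upper c M L (y0 + L) sf fd L0 La LM a0 aS hU
  (lt0r_neq0 T0) (fun=> T0) ltac:(by rewrite addrAC subrr add0r gtr0_norm).
have := @horiz_decay S f a lower c M L (y0 - L) sf fd L0 La LM a0 aS hL
  ltac:(by rewrite lt_eqF) (fun=> B0) ltac:(by rewrite addrAC subrr add0r normrN gtr0_norm).
have vU X := @vert_decay S f a upper c M L X 0 (y0 + L) sf fd L0 La LM a0 aS hU
  (ltW T0) ltac:(by move=> y /andP[y1 _]; rewrite gt_eqF).
have vL X := @vert_decay S f a lower c M L X (y0 - L) 0 sf fd L0 La LM a0 aS hL
  (ltW B0) ltac:(by move=> y /andP[_ y1]; rewrite lt_eqF).
have eR : `|x0 + L - Re a| = L by rewrite addrAC subrr add0r gtr0_norm.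
have eL : `|x0 - L - Re a| = L by rewrite addrAC subrr add0r normrN gtr0_norm.
have := vU _ eR; have := vU _ eL; have := vL _ eR; have := vL _ eL.
rewrite -/Gp -/Gm -/x0 -/k.
(* On the axis both extensions take their boundary values, and the subtracted [f a] cancels in the
   difference of the two quotients. *)
have -> : sint (fun x : R => Re ((bvalue upper f x - bvalue lower f x) / (x%:C - a)))
      (x0 - L) (x0 + L) = sint (fun x => Re (Gp (x +i* 0))) (x0 - L) (x0 + L) -
      sint (fun x => Re (Gm (x +i* 0))) (x0 - L) (x0 + L).
  rewrite -(sintB _ _ (@continuous_Re_horiz R _ 0 cGp) (@continuous_Re_horiz R _ 0 cGm)).
  congr (sint _ _ _); apply/funext => x.
  rewrite -RecB /Gp /Gm !bext_out /=; [|by rewrite /upper_half_plane/lower_half_plane /= ltxx..].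
  rewrite (bvalue_quot _ sf a0 hU) (bvalue_quot _ sf a0 hL) -mulrBl.
  by congr (Re (_ / _)); rewrite opprB addrA subrK.
have yL1 : y0 + L - y0 = L by ring.
have yL2 : y0 - L - y0 = - L by ring.
have xL1 : x0 + L - x0 = L by ring.
have xL2 : x0 - L - x0 = - L by ring.
have LN0 : - L != 0 by rewrite oppr_eq0 lt0r_neq0.
(* Opposite sides combine into a Poisson kernel; each of the two pairs contributes [pi * Im k],
   which together give the term [2 * pi * Im (f a)]. *)
have E1 : sint (fun x => Re (k / (x +i* (y0 + L) - a))) (x0 - L) (x0 + L) -
  sint (fun x => Re (k / (x +i* (y0 - L) - a))) (x0 - L) (x0 + L) = pi * Im k.
  rewrite -(sintB _ _ (@continuous_Re_div k a (y0 + L) _)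
    (@continuous_Re_div k a (y0 - L) _)); last 2 first.
  - by rewrite -subr_eq0 yL1 lt0r_neq0.
  - by rewrite -subr_eq0 yL2.
  rewrite -(sint_poisson (Im k) x0 L0); congr (sint _ _ _); apply/funext => x.
  by rewrite !Re_div !RecB !ImcB /= -/x0 -/y0 yL1 yL2 sqrrN -mulrBl; congr (_ / _); ring.
have E2 : sint (fun y => Im (k / ((x0 + L) +i* y - a))) (y0 - L) (y0 + L) -
  sint (fun y => Im (k / ((x0 - L) +i* y - a))) (y0 - L) (y0 + L) = pi * Im k.
  rewrite -(sintB _ _ (@continuous_Im_div k a (x0 + L) _)
    (@continuous_Im_div k a (x0 - L) _)); last 2 first.
  - by rewrite -subr_eq0 xL1 lt0r_neq0.
  - by rewrite -subr_eq0 xL2.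
  rewrite -(sint_poisson (Im k) y0 L0); congr (sint _ _ _); apply/funext => y.
  rewrite !Im_div !RecB !ImcB /= -/x0 -/y0 xL1 xL2 sqrrN -mulrBl [L ^+ 2 + _]addrC.
  by congr (_ / _); ring.
move: E2; have cc X : X - x0 != 0 -> continuous (fun y : R => Im (k / (X +i* y - a))).
  by move=> X0; apply: continuous_Im_div; rewrite -subr_eq0.
rewrite (sint_add (cc (x0 + L) ltac:(by rewrite xL1 lt0r_neq0)) (ltW B0) (ltW T0)).
rewrite (sint_add (cc (x0 - L) ltac:(by rewrite xL2)) (ltW B0) (ltW T0)).
have E3 : 2 * c / L ^+ 2 * (y0 + L - 0) + 2 * c / L ^+ 2 * (0 - (y0 - L)) = 4 * c / L.
  by field; rewrite lt0r_neq0.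
have -> : 16 * c / L = 4 * (4 * c / L) by field; rewrite lt0r_neq0.
move=> E2 h1 h2 h3 h4 h5 h6 h7 h8; exact: (cauchy_jump_arith E1 E3 E2 h1 h2 h3 h4 h5 h6 h7 h8).
Qed.

End Cauchy.

(** * Liouville's theorem with polynomial growth *)

Section Liouville.
Variable R : realType.
Local Notation C := (R[i] : numFieldType).
Local Notation Re := (@complex.Re R).
Local Notation Im := (@complex.Im R).
Local Notation upper := (@upper_half_plane R).
Local Notation lower := (@lower_half_plane R).
Implicit Types (f g : C -> C) (H : set C) (S : seq R).
Local Notation sana := sectionally_analytic.

Lemma le_div_large_eq0 (x K L0 : R) : (forall L, 0 < L -> L0 <= L -> `|x| <= K / L) -> x = 0.
Proof.
move=> h; apply/eqP; rewrite -normr_le0; apply/ler_addgt0Pl => e e0; rewrite addr0.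
pose L := Num.max 1 (Num.max L0 (K / e)).
have L1 : 1 <= L by rewrite le_max lexx.
have LL0 : L0 <= L by rewrite !le_max lexx orbT.
have LK : K / e <= L by rewrite !le_max lexx !orbT.
have L0' : 0 < L by rewrite (lt_le_trans ltr01).
by apply: le_trans (h _ L0' LL0) _; rewrite ler_pdivrMr// -ler_pdivrMl// mulrC.
Qed.

Lemma sint0 (a b : R) : sint (fun=> 0) a b = 0.
Proof. by rewrite /sint Rintegral_cst// mul0r. Qed.

Lemma exists_notin S (a b : R) : a < b -> exists2 t, a < t < b & t \notin S.
Proof.
move=> ab; suff [a' [b' [aa' ab' bb' h]]] : exists a' b', [/\ a <= a', a' < b', b' <= b &
    forall t, a' < t < b' -> t \notin S].
  have m : a' < (a' + b') / 2 < b' by apply/andP; split; lra.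
  exists ((a' + b') / 2); last exact: h.
  by move: m => /andP[? ?]; apply/andP; split; lra.
elim: S => [|s S [a' [b' [aa' ab' bb' h]]]]; first by exists a, b; split.
have [sm|ms] := leP s ((a' + b') / 2).
  exists ((a' + b') / 2), b'; split => //; [lra|lra|].
  move=> t /andP[t1 t2]; rewrite inE negb_or h ?andbT; last by apply/andP; split; lra.
  by rewrite gt_eqF// (le_lt_trans sm).
exists a', ((a' + b') / 2); split => //; [lra|lra|].
move=> t /andP[t1 t2]; rewrite inE negb_or h ?andbT; last by apply/andP; split; lra.
by rewrite lt_eqF// (lt_trans t2).
Qed.

(** Without a jump Cauchy's formula leaves [2 pi |Im f(a)| <= 16 c / L] for all large [L]. The real
    part follows from the same bound for [i f]. *)
Lemma decay_nojump_eq0 S f (c M : R) : sana S f ->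
  (forall x, bvalue upper f x = bvalue lower f x) ->
  (forall z, Im z != 0 -> M <= cabs z -> cabs (f z) * cabs z <= c) ->
  forall z, Im z != 0 -> f z = 0.
Proof.
move=> sf nj fd.
have hU : half_plane upper by left.
have hL : half_plane lower by right.
have im0 g : sana S g -> (forall x, bvalue upper g x = bvalue lower g x) ->
    (forall z, Im z != 0 -> M <= cabs z -> cabs (g z) * cabs z <= c) ->
    forall a, Im a != 0 -> Im a \notin S -> Im (g a) = 0.
  move=> sg njg gd a a0 aS.
  suff /eqP : 2 * pi * Im (g a) = 0.
    by rewrite mulf_eq0 mulf_eq0 pnatr_eq0 /= gt_eqF ?pi_gt0//= => /eqP.
  apply: (@le_div_large_eq0 _ (16 * c) (Num.max (2 * cabs a) (2 * M))) => L L0.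
  rewrite ge_max => /andP[L1 L2]; have := cauchy_jump sg gd a0 aS L0 L1 L2.
  rewrite (_ : (fun x : R => _) = fun=> 0) ?sint0 ?add0r//.
  by apply/funext => x; rewrite njg subrr mul0r.
have offS a : Im a != 0 -> Im a \notin S -> f a = 0.
  move=> a0 aS; apply/eqP; rewrite eq_complex /= (im0 f sf nj fd a a0 aS) eqxx andbT.
  have sif : sana S (fun z => 'i * f z) by exact: sanaM (sana_cst S 'i) sf.
  have nif x : bvalue upper (fun z => 'i * f z) x = bvalue lower (fun z => 'i * f z) x.
    by rewrite !(bvalueM _ (sana_cst S 'i) sf)// !bvalue_cst// nj.
  have i1 : cabs 'i = 1 :> R by rewrite /cabs normc_def /= expr0n /= add0r expr1n sqrtr1.
  have := im0 _ sif nif _ a a0 aS; rewrite ImcM /= mul0r mul1r add0r => -> //.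
  by move=> z z0 Mz; rewrite cabsM i1 mul1r; exact: fd.
(* Points at exceptional heights are reached by continuity, moving up slightly to a height that is
   neither in [S] nor zero. *)
move=> z z0; have [_ cf _] := sf.
apply/eqP; rewrite -cabs_eq0; apply/eqP/le_anti; rewrite cabs_ge0 andbT.
apply/ler_addgt0Pl => e e0; rewrite addr0.
have /(@cvg_cabsP R _ _ (nbhs_filter (z : C)))/(_ e e0)/nbhs_cabsP[d d0 h] := cf z z0.
have md : 0 < Num.min d `|Im z| by rewrite lt_min d0 normr_gt0.
have [t /andP[t1 t2] tS] := @exists_notin S (Im z) (Im z + Num.min d `|Im z|) ltac:(by rewrite ltrDl).
have td : t - Im z < d.
  by rewrite -ltrBlDl in t2; rewrite (lt_le_trans t2)// ge_min lexx.
have tz : t - Im z < `|Im z|.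
  by rewrite -ltrBlDl in t2; rewrite (lt_le_trans t2)// ge_min lexx orbT.
have t0 : t != 0.
  apply/eqP => te; move: tz t1; rewrite te sub0r => + zn.
  by rewrite ltr0_norm// ltxx.
have wz : cabs ((Re z +i* t) - z) < d.
  apply: le_lt_trans (cabs_ReIm _) _; rewrite RecB ImcB /= subrr normr0 add0r.
  by rewrite gtr0_norm// subr_gt0.
by have := h _ wz; rewrite offS//= sub0r cabsN.
Qed.

(** The growth condition means [f = O(z^(e - 1))], so that [e = 0] is the decaying case. The
    induction passes to a difference quotient, which lowers the growth by one and adds one
    exceptional height; this is why [S] varies. *)
Lemma liouville e S f (c M : R) : sana S f ->
  (forall x, bvalue upper f x = bvalue lower f x) ->
  (forall z, Im z != 0 -> M <= cabs z -> cabs (f z) * cabs z <= c * cabs z ^+ e) ->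
  exists2 P : {poly R[i]}, (size P <= e)%N & forall z, Im z != 0 -> f z = P.[z].
Proof.
elim: e S f c M => [|e IH] S f c M sf nj fd.
  exists 0; first by rewrite size_poly0.
  move=> z z0; rewrite horner0; apply: (decay_nojump_eq0 sf nj _ z0) => w w0 Mw.
  by have := fd w w0 Mw; rewrite expr0 mulr1; apply.
have [t /andP[t0 t1] tS] := exists_notin S (@ltr01 R).
(* Since [|a| < 1], every [z] with [|z| >= 2] satisfies [|z| <= 2 |z - a|], the source of the factor
   2 in the new constant. *)
pose a : C := 0 +i* t; have a0 : Im a != 0 by rewrite /= gt_eqF.
have ca : cabs a = t by rewrite /cabs normc_def /= expr0n /= add0r sqrtr_sqr gtr0_norm.
have sq := sana_quot sf a0 tS.
have nq x : bvalue upper (quot f a) x = bvalue lower (quot f a) x.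
  by rewrite (bvalue_quot _ sf a0 (or_introl erefl)) (bvalue_quot _ sf a0 (or_intror erefl)) nj.
have [z z0 Mz|P sP fP] := IH _ _ (2 * (c + cabs (f a))) (Num.max M 2) sq nq.
  move: Mz; rewrite ge_max => /andP[Mz z2].
  have zp : 0 < cabs z by rewrite (lt_le_trans _ z2).
  have za : cabs z <= 2 * cabs (z - a) by have := cabsD (z - a) a; rewrite subrK ca; lra.
  have zna : z != a by rewrite -subr_eq0 -cabs_gt0; lra.
  have zap : 0 < cabs (z - a) by rewrite cabs_gt0 subr_eq0.
  rewrite (quotE _ zna) cabsM cabsV mulrAC ler_pdivrMr//.
  have fz : cabs (f z) <= c * cabs z ^+ e.
    by have := fd z z0 Mz; rewrite exprSr mulrA ler_pM2r.
  have fa : cabs (f a) <= cabs (f a) * cabs z ^+ e.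
    by rewrite ler_peMr ?cabs_ge0// exprn_ege1//; lra.
  apply: (@le_trans _ _ ((c + cabs (f a)) * cabs z ^+ e * (2 * cabs (z - a)))).
    apply: ler_pM; rewrite ?cabs_ge0//.
    by apply: le_trans (cabsB _ _) _; rewrite mulrDl lerD.
  by rewrite le_eqVlt; apply/orP; left; apply/eqP; ring.
exists (P * ('X - a%:P) + (f a)%:P).
  apply: leq_trans (size_polyD _ _) _; rewrite geq_max; apply/andP; split.
    by apply: leq_trans (size_polyMleq _ _) _; rewrite size_XsubC addn2 ltnS.
  by apply: leq_trans (size_polyC_leq1 _) _.
move=> z z0; rewrite hornerD hornerM hornerXsubC hornerC -fP//.
have [->|za] := eqVneq z a; first by rewrite subrr mulr0 add0r.
by rewrite quotE// divfK ?subrK// subr_eq0.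
Qed.

End Liouville.

(** * Determinants and adjugates of matrices of such functions *)

Section SectionallyAnalyticMatrices.
Variable R : realType.
Local Notation C := (R[i] : numFieldType).
Local Notation Re := (@complex.Re R).
Local Notation Im := (@complex.Im R).
Local Notation upper := (@upper_half_plane R).
Local Notation lower := (@lower_half_plane R).
Implicit Types (f g : C -> C) (H : set C) (S : seq R).
Local Notation sana := sectionally_analytic.

Lemma cabs_sum (I : Type) (r : seq I) (P : pred I) (F : I -> R[i]) :
  cabs (\sum_(i <- r | P i) F i) <= \sum_(i <- r | P i) cabs (F i).
Proof.
elim/big_ind2: _ => //; first by rewrite cabs0.
by move=> z x w y h1 h2; apply: le_trans (cabsD _ _) (lerD h1 h2).
Qed.

Lemma cabs_prod (I : Type) (r : seq I) (P : pred I) (F : I -> R[i]) :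
  cabs (\prod_(i <- r | P i) F i) = \prod_(i <- r | P i) cabs (F i).
Proof.
elim/big_ind2: _ => //; first by rewrite /cabs normr1.
by move=> z x w y <- <-; rewrite cabsM.
Qed.

Lemma cabs_sign k : cabs ((-1) ^+ k : R[i]) = 1.
Proof. by rewrite /cabs normrX normrN1 expr1n. Qed.

Lemma det_bound m (K : R) : exists2 K' : R, 0 <= K' &
  forall A : 'M[R[i]]_m, (forall i j, cabs (A i j) <= K) -> cabs (\det A) <= K'.
Proof.
exists (\sum_(s : 'S_m) \prod_(i < m) `|K|).
  by apply: sumr_ge0 => s _; apply: prodr_ge0.
move=> A AK; apply: le_trans (cabs_sum _ _ _) _; apply: ler_sum => s _.
rewrite cabsM cabs_sign mul1r cabs_prod; apply: ler_prod => i _.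
by rewrite cabs_ge0 (le_trans (AK _ _))// ler_norm.
Qed.

Lemma adj_bound m (K : R) : exists2 K' : R, 0 <= K' &
  forall A : 'M[R[i]]_m, (forall i j, cabs (A i j) <= K) ->
  forall i j, cabs ((\adj A) i j) <= K'.
Proof.
have [K' K'0 hK] := det_bound m.-1 K; exists K' => // A AK i j.
rewrite mxE cabsM cabs_sign mul1r; apply: hK => i' j'.
by rewrite !mxE.
Qed.

(** A null row vector satisfies [v = - v E], so its [l^1] norm is at most [m d] times itself, which
    is impossible for a nonzero vector. *)
Lemma det_1D_neq0 m (E : 'M[R[i]]_m) (d : R) : (forall i j, cabs (E i j) <= d) ->
  m%:R * d < 1 -> \det (1%:M + E) != 0.
Proof.
move=> Ed d1; apply/det0P => -[v v0 vE].
have ve j : cabs (v 0 j) <= \sum_i cabs (v 0 i) * d.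
  have : (v *m (1%:M + E)) 0 j = 0 by rewrite vE mxE.
  rewrite mulmxDr mulmx1 mxE => /eqP; rewrite addr_eq0 => /eqP ->.
  rewrite cabsN mxE; apply: le_trans (cabs_sum _ _ _) _; apply: ler_sum => i _.
  by rewrite cabsM ler_wpM2l ?cabs_ge0.
pose s := \sum_i cabs (v 0 i).
have s0 : 0 < s.
  have [j vj] : exists j, v 0 j != 0.
    apply/existsP; apply: contraNT v0; rewrite negb_exists => /forallP v0.
    by apply/eqP/rowP => j; have /negPn/eqP -> := v0 j; rewrite mxE.
  rewrite /s (bigD1 j)//= ltr_pwDl ?cabs_gt0//.
  by apply: sumr_ge0 => i _; exact: cabs_ge0.
have : s <= m%:R * d * s.
  apply: (@le_trans _ _ (\sum_(j < m) s * d)); last first.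
    by rewrite sumr_const card_ord -(mulr_natl (s * d)) [s * d]mulrC mulrA.
  by apply: ler_sum => j _; rewrite (le_trans (ve j))// -mulr_suml.
by rewrite leNgt gtr_pMl// d1.
Qed.

Lemma sana_det S m (A : C -> 'M[C]_m) : (forall i j, sana S (fun z => A z i j)) ->
  sana S (fun z => \det (A z)).
Proof.
move=> sA; apply: sana_sum => s; apply: sanaM; first exact: sana_cst.
by apply: sana_prod => i; exact: sA.
Qed.

Lemma bvalue_det S m (A : C -> 'M[C]_m) H x : (forall i j, sana S (fun z => A z i j)) ->
  half_plane H -> bvalue H (fun z => \det (A z)) x = \det (boundary_value A H x).
Proof.
move=> sA hH; rewrite (@bvalue_sum _ S)//; last first.
  move=> s; apply: sanaM; first exact: sana_cst.
  by apply: sana_prod => i; exact: sA.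
apply: eq_bigr => s _.
rewrite (bvalueM _ (sana_cst S _) (sana_prod _ _ (fun i => sA i (s i))) hH).
rewrite (bvalue_cst _ _ hH) (bvalue_prod _ _ _ (fun i => sA i (s i)) hH).
by congr (_ * _); apply: eq_bigr => i _; rewrite mxE.
Qed.

Lemma sana_minor S m (A : C -> 'M[C]_m) i j : (forall i j, sana S (fun z => A z i j)) ->
  forall i' j', sana S (fun z => row' i (col' j (A z)) i' j').
Proof.
move=> sA i' j'; rewrite (_ : (fun z => _) = fun z => A z (lift i i') (lift j j')) //.
by apply/funext => z; rewrite !mxE.
Qed.

Lemma sana_adj S m (A : C -> 'M[C]_m) i j : (forall i j, sana S (fun z => A z i j)) ->
  sana S (fun z => (\adj (A z)) i j).
Proof.
move=> sA; under eq_fun do rewrite mxE; apply: sanaM; first exact: sana_cst.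
exact: sana_det (sana_minor _ _ sA).
Qed.

Lemma bvalue_adj S m (A : C -> 'M[C]_m) H x i j : (forall i j, sana S (fun z => A z i j)) ->
  half_plane H -> bvalue H (fun z => (\adj (A z)) i j) x = (\adj (boundary_value A H x)) i j.
Proof.
move=> sA hH; under eq_fun do rewrite mxE.
rewrite (bvalueM _ (sana_cst S _) (sana_det (sana_minor _ _ sA)) hH).
rewrite (bvalue_cst _ _ hH) (bvalue_det _ (sana_minor _ _ sA) hH) mxE.
congr (_ * \det _); apply/matrixP => i' j'; rewrite !mxE.
suff -> : (fun z => row' j (col' i (A z)) i' j') = (fun z => A z (lift j i') (lift i j')) by [].
by apply/funext => z; rewrite !mxE.
Qed.

End SectionallyAnalyticMatrices.

(** * The inverse of the Riemann-Hilbert solution *)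

Section RiemannHilbertInverse.
Variable R : realType.
Local Notation C := (R[i] : numFieldType).
Local Notation Re := (@complex.Re R).
Local Notation Im := (@complex.Im R).
Local Notation upper := (@upper_half_plane R).
Local Notation lower := (@lower_half_plane R).
Local Notation sana := sectionally_analytic.
Variables (p q : nat) (w1 : 'I_p -> R -> R) (w2 : 'I_q -> R -> R).
Variables (n : 'I_p -> nat) (m : 'I_q -> nat) (Y : C -> 'M[C]_(p + q)).
Hypothesis hY : is_RH_solution w1 w2 n m Y.
Hypothesis hnm : (\sum_j n j = \sum_k m k)%N.

Lemma RH_sana i j : sana [::] (fun z => Y z i j).
Proof.
case: hY => an [up lo] _ _; split.
- by move=> z z0 _; exact: an.
- by move=> z z0; apply: derivable_continuous; exact: an.
- by move=> H x [->|->]; [exact: up | exact: lo].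
Qed.

Lemma det_RH_growth (z : C) : z != 0 -> \det (RH_growth n m z) = 1.
Proof.
move=> z0; rewrite det_diag big_split_ord /=.
under eq_bigr do rewrite row_mxEl mxE.
under [X in _ * X]eq_bigr do rewrite row_mxEr mxE.
by rewrite prodfV !prodrXr hnm mulfV// expf_neq0.
Qed.

Lemma det_RH_jump x : \det (RH_jump w1 w2 x) = 1.
Proof. by rewrite /RH_jump det_ublock !det1 mulr1. Qed.

(** The unit determinants of jump and growth matrix make [det Y] continue across the axis and stay
    bounded, so Liouville gives a constant. It is nonzero because [1 + E] is invertible far out. *)
Lemma det_RH_cst : exists2 d : R[i], d != 0 & forall z, Im z != 0 -> \det (Y z) = d.
Proof.
have [_ _ jump [E [c [M [M0 hE]]]]] := hY.
have sd := sana_det RH_sana.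
have detE z : Im z != 0 -> M <= cabs z -> \det (Y z) = \det (1%:M + E z).
  move=> z0 Mz; have [_ ->] := hE z z0 ltac:(by rewrite cabsE lecR).
  rewrite det_mulmx det_RH_growth ?mulr1//.
  by apply: contraNneq z0 => ->.
have Eb z : Im z != 0 -> M <= cabs z -> forall i j, cabs (E z i j) <= c / cabs z.
  move=> z0 Mz i j; have [+ _] := hE z z0 ltac:(by rewrite cabsE lecR).
  by move=> /(_ i j); rewrite !cabsE -fmorphV -rmorphM lecR.
have [K K0 hK] := @det_bound R (p + q) (1 + `|c| / M).
have [P sP fP] : exists2 P : {poly R[i]}, (size P <= 1)%N &
    forall z, Im z != 0 -> \det (Y z) = P.[z].
  apply: (@liouville R 1 [::] _ K M sd).
    move=> x; rewrite (bvalue_det _ RH_sana (or_introl erefl)) (bvalue_det _ RH_sana (or_intror erefl)).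
    have := jump x; rewrite /Yplus /Yminus => ->.
    by rewrite det_mulmx det_RH_jump mulr1.
  move=> z z0 Mz; rewrite expr1 ler_wpM2r ?cabs_ge0// detE//; apply: hK => i j.
  rewrite mxE; apply: le_trans (cabsD _ _) _; apply: lerD.
    by rewrite mxE; case: (i == j); rewrite ?cabs0 ?ler01// /cabs normr1.
  apply: le_trans (Eb z z0 Mz i j) _.
  have zp : 0 < cabs z by rewrite (lt_le_trans M0).
  apply: (@le_trans _ _ (`|c| / cabs z)).
    by rewrite ler_wpM2r ?ler_norm// invr_ge0 ltW.
  by rewrite ler_wpM2l// lef_pV2.
have [d Pd] : exists d, P = d%:P by exists P`_0; exact: size1_polyC.
exists d; last by move=> z z0; rewrite fP// Pd hornerC.
(* At height [L] the entries of [E] are at most [|c| / L], and this choice makes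
   [(p + q) |c| / L < 1]. *)
pose L := Num.max M ((p + q)%:R * `|c| + 1).
have LM : M <= L by rewrite le_max lexx.
have Lc : (p + q)%:R * `|c| + 1 <= L by rewrite le_max lexx orbT.
have L0 : 0 < L by rewrite (lt_le_trans M0).
have cL : cabs (0 +i* L) = L by rewrite /cabs normc_def /= expr0n /= add0r sqrtr_sqr gtr0_norm.
have I0 : Im (0 +i* L) != 0 by rewrite /= gt_eqF.
have -> : d = \det (Y (0 +i* L)) by rewrite fP// Pd hornerC.
rewrite detE ?cL//; apply: (@det_1D_neq0 _ _ _ (`|c| / L)).
  move=> i j; apply: le_trans (Eb _ I0 _ i j) _; rewrite cL//.
  by rewrite ler_wpM2r ?ler_norm// invr_ge0 ltW.
by rewrite mulrA ltr_pdivrMr// mul1r; lra.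
Qed.

(** The bounds come from [RH_growth z *m V z = (1 + E z)^-1], which is bounded: undoing the diagonal
    scaling row by row gives the powers [n j] and [m k]. *)
Lemma RH_inverse : exists V : C -> 'M[C]_(p + q),
  [/\ forall i j, sana [::] (fun z => V z i j),
      forall z, Im z != 0 -> V z *m Y z = 1%:M,
      forall x, boundary_value V upper x = invmx (Yplus Y x),
      forall x, boundary_value V lower x = RH_jump w1 w2 x *m boundary_value V upper x &
      exists K M : R, forall z, Im z != 0 -> M <= cabs z ->
        (forall j i, cabs z ^+ n j * cabs (V z (lshift q j) i) <= K) /\
        (forall k i, cabs (V z (rshift p k) i) <= K * cabs z ^+ m k)].
Proof.
have [_ _ jump [E [c [M [M0 hE]]]]] := hY.
have [d d0 detY] := det_RH_cst.
have sY := RH_sana.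
have hU : half_plane upper by left.
have hL : half_plane lower by right.
(* With a constant determinant the inverse is polynomial in the entries of [Y], so analyticity and
   boundary values pass through sums and products. *)
pose V (z : C) : 'M[C]_(p + q) := d^-1 *: \adj (Y z).
have VE z i j : V z i j = d^-1 * (\adj (Y z)) i j by rewrite mxE.
have detB H x : half_plane H -> \det (boundary_value Y H x) = d.
  move=> hH; rewrite -(bvalue_det _ sY hH).
  apply: bvalue_lim => //; apply: cvg_near_cst; apply/bfilterP; exists 1 => // w Hw _.
  by apply: detY; case: hH Hw => ->; rewrite /upper_half_plane /lower_half_plane /= => h;
    rewrite ?(gt_eqF h) ?(lt_eqF h).
have unitB H x : half_plane H -> boundary_value Y H x \in unitmx.
  by move=> hH; rewrite unitmxE detB// unitfE.
have VB H x : half_plane H -> boundary_value V H x = invmx (boundary_value Y H x).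
  move=> hH; rewrite /invmx unitB// detB//; apply/matrixP => i j; rewrite [LHS]mxE [RHS]mxE.
  rewrite -(bvalue_adj _ _ _ sY hH) -(bvalue_cst x (d^-1) hH).
  rewrite -(bvalueM _ (sana_cst [::] _) (sana_adj _ _ sY) hH).
  suff -> : (fun z => V z i j) = (fun z => d^-1 * (\adj (Y z)) i j) by [].
  by apply/funext => z; rewrite VE.
exists V; split.
- move=> i j; under eq_fun do rewrite VE.
  by apply: sanaM (sana_cst _ _) (sana_adj _ _ sY).
- move=> z z0; rewrite -scalemxAl mul_adj_mx detY//.
  by rewrite -mul_scalar_mx -scalar_mxM mulVf.
- by move=> x; rewrite VB.
- move=> x; rewrite !VB//; have jx := jump x; rewrite /Yplus /Yminus in jx.
  have uJ : RH_jump w1 w2 x \in unitmx by rewrite unitmxE det_RH_jump unitr1.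
  apply: (can_inj (mulKmx (unitB lower x hL))).
  by rewrite mulmxV ?unitB// mulmxA -jx mulmxV ?unitB.
- have [K K0 hK] := @adj_bound R (p + q) (1 + `|c| / M).
  exists (cabs d^-1 * K), M => z z0 Mz.
  have zp : 0 < cabs z by rewrite (lt_le_trans M0).
  have zn0 : z != 0 by rewrite -cabs_gt0.
  have [Eb Yz] := hE z z0 ltac:(by rewrite cabsE lecR).
  have det1E : \det (1%:M + E z) = d.
    by rewrite -(detY z z0) Yz det_mulmx det_RH_growth ?mulr1.
  pose U := d^-1 *: \adj (1%:M + E z).
  have GV : RH_growth n m z *m V z = U.
    have YV : Y z *m V z = 1%:M.
      by rewrite -scalemxAr mul_mx_adj detY// -mul_scalar_mx -scalar_mxM mulVf.
    have UE : U *m (1%:M + E z) = 1%:M.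
      by rewrite -scalemxAl mul_adj_mx det1E -mul_scalar_mx -scalar_mxM mulVf.
    by rewrite -[LHS]mul1mx -UE -mulmxA (mulmxA _ _ (V z)) -Yz YV mulmx1.
  have Ub i j : cabs (U i j) <= cabs d^-1 * K.
    rewrite mxE cabsM ler_wpM2l ?cabs_ge0//; apply: hK => i' j'.
    rewrite mxE; apply: le_trans (cabsD _ _) _; apply: lerD.
      by rewrite mxE; case: (i' == j'); rewrite ?cabs0 ?ler01// /cabs normr1.
    have := Eb i' j'; rewrite !cabsE -fmorphV -rmorphM lecR => /le_trans; apply.
    apply: (@le_trans _ _ (`|c| / cabs z)).
      by rewrite ler_wpM2r ?ler_norm// invr_ge0 ltW.
    by rewrite ler_wpM2l// lef_pV2.
  split=> [j i|k i].
    rewrite -cabsX -cabsM; have := Ub (lshift q j) i; rewrite -GV.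
    by rewrite /RH_growth mul_diag_mx mxE row_mxEl mxE.
  have := Ub (rshift p k) i; rewrite -GV.
  rewrite /RH_growth mul_diag_mx mxE row_mxEr mxE => Uki.
  have : cabs ((z ^+ m k)^-1 * V z (rshift p k) i) <= cabs d^-1 * K by [].
  by rewrite cabsM cabsV cabsX mulrC ler_pdivrMr// exprn_gt0.
Qed.

End RiemannHilbertInverse.

(** * Pointwise expansion in a basis of a weighted span *)

Section WeightedSpans.
Variable R : realType.

(** Flattens the pairs (weight, exponent) into one finite index, so that a family of polynomials
    becomes a row vector of length the sum of the [m k]. *)
Lemma sum_horner_monomials (F : comNzRingType) (r : nat) (m : 'I_r -> nat)
    (w : 'I_r -> F) (Q : 'I_r -> {poly F}) (y : F) :
  (forall k, (size (Q k) <= m k)%N) ->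
  \sum_k w k * (Q k).[y] =
  \sum_(t < #|{: {k : 'I_r & 'I_(m k)}}|)
    (Q (tag (enum_val t)))`_(tagged (enum_val t)) *
    (w (tag (enum_val t)) * y ^+ tagged (enum_val t)).
Proof.
move=> sQ; rewrite [RHS](reindex enum_rank) /=; last first.
  by apply: onW_bij; exact: enum_rank_bij.
under [RHS]eq_bigr do rewrite enum_rankK.
rewrite -(@sig_big_dep _ _ _ _ (fun k => 'I_(m k)) predT (fun _ => predT)
  (fun k (s : 'I_(m k)) => (Q k)`_s * (w k * y ^+ s))) /=.
apply: eq_bigr => k _; rewrite (horner_coef_wide _ (sQ k)) mulr_sumr.
by apply: eq_bigr => s _; rewrite mulrCA.
Qed.

(** The coefficients of [psi] in the functions [w_k y^s] form a square matrix, since there are as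
    many such functions as basis elements. A relation between its rows would be a relation between
    the [psi b], so it is invertible, also over the complex numbers. Comparing coefficients gives
    the expansion at every [y]. *)
Lemma weighted_span_spanning (r n : nat) (w : 'I_r -> R -> R) (m : 'I_r -> nat)
    (psi : 'I_n -> R -> R) (Q : 'I_r -> {poly R[i]}) :
  (\sum_k m k = n)%N -> (forall b, weighted_span w m (psi b)) ->
  (forall c : 'I_n -> R, (forall x, \sum_b c b * psi b x = 0) -> forall b, c b = 0) ->
  (forall k, (size (Q k) <= m k)%N) ->
  exists c : 'I_n -> R[i], forall y : R,
    \sum_k (w k y)%:C * (Q k).[y%:C] = \sum_b c b * (psi b y)%:C.
Proof.
move=> mn psiw free sQ; have /choice[A hA] := psiw.
set N := #|{: {k : 'I_r & 'I_(m k)}}|.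
have NE : N = n.
  rewrite /N card_tagged -mn sumnE big_map big_enum /=.
  by apply: eq_bigr => k _; rewrite card_ord.
pose T (t : 'I_N) := enum_val t.
pose M : 'M[R]_(n, N) := \matrix_(b, t) (A b (tag (T t)))`_(tagged (T t)).
have psiE b y : psi b y = \sum_t M b t * (w (tag (T t)) y * y ^+ tagged (T t)).
  have [sA ->] := hA b.
  under eq_bigr do rewrite mulrC.
  rewrite (sum_horner_monomials _ _ sA); apply: eq_bigr => t _.
  by rewrite mxE.
have freeM : row_free M.
  apply: inj_row_free => v vM; apply/rowP => b; rewrite mxE.
  apply: (free (fun b => v 0 b)) => x.
  under eq_bigr do rewrite psiE mulr_sumr.
  rewrite exchange_big /= big1// => t _.
  under eq_bigr do rewrite mulrA.
  rewrite -mulr_suml; have : (v *m M) 0 t = 0 by rewrite vM mxE.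
  by rewrite mxE => ->; rewrite mul0r.
have fullM : row_full (map_mx (real_complex R) M).
  by rewrite row_full_map /row_full (eqP freeM) NE.
pose v : 'rV[R[i]]_N := \row_t (Q (tag (T t)))`_(tagged (T t)).
have /submxP[c vc] : (v <= map_mx (real_complex R) M)%MS by exact: submx_full.
exists (c 0) => y; rewrite (sum_horner_monomials _ _ sQ).
transitivity (\sum_t v 0 t * ((w (tag (T t)) y)%:C * y%:C ^+ tagged (T t))).
  by apply: eq_bigr => t _; rewrite mxE.
rewrite vc; under eq_bigr do rewrite mxE mulr_suml.
rewrite exchange_big /=; apply: eq_bigr => b _.
rewrite psiE rmorph_sum mulr_sumr; apply: eq_bigr => t _.
by rewrite [map_mx _ _ _ _]mxE !rmorphM rmorphXn -mulrA.
Qed.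

End WeightedSpans.

(** * From growing segments to the whole line *)

Section ExpandingIntegrals.
Variable R : realType.
Local Notation mu := (@lebesgue_measure R).

Lemma cvg_sint_setT (F : R -> R) (x0 : R) : mu.-integrable [set: R] (EFin \o F) ->
  sint F (x0 - k%:R) (x0 + k%:R) @[k --> \oo] --> \int[mu]_x F x.
Proof.
move=> iF; pose A (k : nat) : set R := [set` `[x0 - k%:R, x0 + k%:R]].
rewrite (_ : (fun k => _) = (fun k => \int[mu]_x (F \_ (A k)) x)); last first.
  by apply/funext => k; rewrite -Rintegral_mkcond.
have mF := measurable_int mu iF.
pose Fk (k : nat) (x : R) : \bar R := ((F \_ (A k)) x)%:E.
have iFk k : mu.-integrable [set: R] (Fk k).
  have -> : Fk k = (EFin \o F) \_ (A k) by rewrite restrict_EFin.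
  have iFA : mu.-integrable (A k) (EFin \o F).
    by apply: (integrableS _ _ _ iF) => //; exact: measurable_itv.
  exact: (proj1 (@integrable_mkcond _ _ _ mu (A k) (EFin \o F) (measurable_itv _)) iFA).
have mFk k := measurable_int mu (iFk k).
have FA : {ae mu, forall x, [set: R] x ->
    Fk k x @[k --> \oo] --> (EFin \o F) x}.
  apply: aeW => x _; apply: cvg_near_cst.
  exists (Num.bound `|x - x0|) => // k /= xk.
  rewrite /Fk patchE mem_set// /A /= in_itv /=.
  have : `|x - x0| <= k%:R.
    apply: le_trans (ltW (archi_boundP (normr_ge0 _))) _.
    by rewrite ler_nat.
  by rewrite ler_norml => /andP[? ?]; apply/andP; split; lra.
have FB : {ae mu, forall x (k : nat), [set: R] x ->
    (`|Fk k x| <= `|(EFin \o F) x|)%E}.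
  apply: aeW => x k _ /=; rewrite /Fk patchE lee_fin.
  by case: (x \in A k) => //; rewrite normr0.
have [_ _ h] := dominated_convergence measurableT mFk mF FA (integrable_abse iF) FB.
apply: fine_cvg; rewrite fineK; last exact: integrable_fin_num.
exact: h.
Qed.

Lemma Rintegral_lincomb (n : nat) (g : 'I_n -> R -> R) (a : 'I_n -> R) :
  (forall b, mu.-integrable [set: R] (EFin \o g b)) ->
  mu.-integrable [set: R] (EFin \o (fun x => \sum_b a b * g b x)) /\
  \int[mu]_x (\sum_b a b * g b x) = \sum_b a b * \int[mu]_x g b x.
Proof.
move=> ig; elim: (index_enum 'I_n) => [|b s [IH1 IH2]].
  under [X in EFin \o X]eq_fun do rewrite big_nil.
  under eq_Rintegral do rewrite big_nil.
  rewrite big_nil; split; first exact: integrable0.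
  by rewrite Rintegral_cst// mul0r.
have iab : mu.-integrable [set: R] (EFin \o (fun x => a b * g b x)).
  exact: (integrableZl _ (a b) (ig b)).
under [X in EFin \o X]eq_fun do rewrite big_cons.
under eq_Rintegral do rewrite big_cons.
rewrite big_cons; split.
  exact: (integrableD _ iab IH1).
by rewrite RintegralD// IH2 RintegralZl.
Qed.

End ExpandingIntegrals.

(** * Identification of the kernel *)

Section ReproducingKernel.
Variable R : realType.
Local Notation C := (R[i] : numFieldType).
Local Notation Re := (@complex.Re R).
Local Notation Im := (@complex.Im R).
Local Notation upper := (@upper_half_plane R).
Local Notation lower := (@lower_half_plane R).
Local Notation sana := sectionally_analytic.
Local Notation mu := (@lebesgue_measure R).
Local Notation toC := (map_poly (real_complex R)).

Lemma horner_growth (P : {poly R[i]}) e : (size P <= e)%N ->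
  exists K : R, forall z, 1 <= cabs z -> cabs P.[z] * cabs z <= K * cabs z ^+ e.
Proof.
move=> sP; exists (\sum_(i < e) cabs P`_i) => z z1.
rewrite (horner_coef_wide _ sP).
apply: (@le_trans _ _ (\sum_(i < e) cabs (P`_i * z ^+ i) * cabs z)).
  by rewrite -mulr_suml ler_wpM2r ?cabs_ge0// cabs_sum.
rewrite mulr_suml; apply: ler_sum => i _.
rewrite cabsM cabsX -mulrA -exprSr ler_wpM2l ?cabs_ge0//.
by rewrite ler_weXn2l.
Qed.

Variables (p q : nat) (w1 : 'I_p -> R -> R) (w2 : 'I_q -> R -> R).
Variables (n : nat) (nn : 'I_p -> nat) (mm : 'I_q -> nat).
Hypotheses (hn : (\sum_j nn j)%N = n) (hm : (\sum_k mm k)%N = n).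
Hypotheses (hF : weighted_span w1 nn `<=` L2 R) (hG : weighted_span w2 mm `<=` L2 R).
Variables phi psi : 'I_n -> R -> R.
Hypotheses (hphi : L2_basis (weighted_span w1 nn) phi)
  (hpsi : L2_basis (weighted_span w2 mm) psi) (hbi : biorthogonal phi psi).
Variable Y : C -> 'M[C]_(p + q).
Hypothesis hY : is_RH_solution w1 w2 nn mm Y.

Lemma integrable_phi_psi l b :
  mu.-integrable [set: R] (EFin \o (fun u => phi l u * psi b u)).
Proof.
have [inF _ _] := hphi; have [inG _ _] := hpsi.
by apply/Lfun1_integrable; exact: (Lfun2_mul_Lfun1 (hF (inF l)) (hG (inG b))).
Qed.

Lemma jump_mulE u (X : 'M[R[i]]_(p + q)) i :
  (forall j, (RH_jump w1 w2 u *m X) (lshift q j) i =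
    X (lshift q j) i + \sum_k (w1 j u * w2 k u)%:C * X (rshift p k) i) /\
  (forall k, (RH_jump w1 w2 u *m X) (rshift p k) i = X (rshift p k) i).
Proof.
split=> [j|k]; rewrite mxE big_split_ord /=.
  congr (_ + _).
    under eq_bigr do rewrite /RH_jump block_mxEul mxE.
    rewrite (bigD1 j)//= eqxx mul1r big1 ?addr0// => j' /negbTE.
    by rewrite eq_sym => ->; rewrite mul0r.
  by apply: eq_bigr => k _; rewrite /RH_jump block_mxEur mxE.
rewrite big1 ?add0r; last by move=> j _; rewrite /RH_jump block_mxEdl mxE mul0r.
under eq_bigr do rewrite /RH_jump block_mxEdr mxE.
rewrite (bigD1 k)//= eqxx mul1r big1 ?addr0// => k' /negbTE.
by rewrite eq_sym => ->; rewrite mul0r.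
Qed.

(** Kept in multiplied form: the factor [x - y] arises as the boundary value of the factor [z - v]
    in [claim]. *)
Lemma RH_kernel x y :
  ((row_mx 0 (\row_k (w2 k y)%:C) : 'rV[R[i]]_(p + q))
     *m invmx (Yplus Y y) *m Yplus Y x
     *m (col_mx (\col_j (w1 j x)%:C) 0 : 'cV[R[i]]_(p + q))) 0 0 =
  2 * (pi : R)%:C * 'i%C * (x - y)%:C * (CD_kernel phi psi x y)%:C.
Proof.
have hU : half_plane upper by left.
have hL : half_plane lower by right.
have [V [sV VY Vup Vlow [K [M VK]]]] := RH_inverse hY (etrans hn (esym hm)).
have sY := RH_sana hY.
have VbE H u i j : bvalue H (fun z => V z i j) u = boundary_value V H u i j by rewrite mxE.
(* The last [q] rows are unchanged by the jump matrix. Growth [z^(m_k)] corresponds to the exponent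
   [m_k + 1] in [liouville], hence to degree at most [m_k]. *)
have /choice[B' hB'] : forall ki : 'I_q * 'I_(p + q), exists B : {poly R[i]},
    (size B <= (mm ki.1).+1)%N /\ forall z, Im z != 0 -> V z (rshift p ki.1) ki.2 = B.[z].
  move=> [k i] /=; have [|z z0 Mz|B sB VB] := @liouville R (mm k).+1 [::] _ K M (sV (rshift p k) i).
  - by move=> u; rewrite !VbE Vlow; have [_ ->] := jump_mulE u (boundary_value V upper u) i.
  - by have [_ /(_ k i) h] := VK z z0 Mz; rewrite exprSr mulrA ler_wpM2r ?cabs_ge0.
  - by exists B.
pose B k i := B' (k, i).
have sB k i : (size (B k i) <= (mm k).+1)%N by case: (hB' (k, i)).
have VB z k i : Im z != 0 -> V z (rshift p k) i = (B k i).[z] by case: (hB' (k, i)) => _; apply.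
have upB (u : R) k i : boundary_value V upper u (rshift p k) i = (B k i).[u%:C].
  rewrite -VbE; apply: bvalue_lim => //.
  have nb : \forall z \near bfilter upper u, (B k i).[z] = V z (rshift p k) i.
    by apply/bfilterP; exists 1 => // z zu _; rewrite VB// gt_eqF.
  apply: cvg_trans (near_eq_cvg nb) _.
  by rewrite -(bvalue_horner (B k i) u hU); exact: bvalue_cvg (sana_horner [::] _) hU.
have [inF _ _] := hphi; have /choice[A hA] := inF.
have sA l j : (size (A l j) <= nn j)%N by case: (hA l).
have phiE l u : phi l u = \sum_j (A l j).[u] * w1 j u by case: (hA l) => _ ->.
have claim j (z : R[i]) (v : R) : 0 < Im z ->
    \sum_i (\sum_k (w2 k v)%:C * (B k i).[v%:C]) * Y z i (lshift q j) =
    2 * (pi : R)%:C * 'i%C * (z - v%:C) * \sum_b (toC (A b j)).[z] * (psi b v)%:C.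
  move=> zp; have z0 : Im z != 0 by rewrite gt_eqF.
  (* At [z] this polynomial takes the value of entry [(p + k, j)] of [V z *m Y z = 1], which is off
     the diagonal. *)
  pose P k := \sum_i Y z i (lshift q j) *: B k i.
  have Pz k : root (P k) z.
    rewrite /root /P horner_sum; apply/eqP.
    transitivity ((V z *m Y z) (rshift p k) (lshift q j)).
      by rewrite mxE; apply: eq_bigr => i _; rewrite hornerZ VB// mulrC.
    by rewrite VY// mxE eq_rlshift.
  have /choice[Q hQ] : forall k, exists Q, P k = Q * ('X - z%:P).
    by move=> k; apply/factor_theorem.
  have sQ k : (size (Q k) <= mm k)%N.
    have [->|Q0] := eqVneq (Q k) 0; first by rewrite size_poly0.
    have : (size (P k) <= (mm k).+1)%N.
      apply: leq_trans (size_sum _ _ _) _; apply/bigmax_leqP => i _.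
      by apply: leq_trans (size_scale_leq _ _) _.
    by rewrite hQ size_Mmonic ?monicXsubC// size_XsubC addn2.
  have [inG freeG _] := hpsi.
  have [|c cE] := weighted_span_spanning hm inG _ sQ.
    by move=> c c0; apply: freeG; apply: aeW => u; exact: c0.
  have TE (u : R) : \sum_i (\sum_k (w2 k u)%:C * (B k i).[u%:C]) * Y z i (lshift q j) =
      (u%:C - z) * \sum_b c b * (psi b u)%:C.
    rewrite -cE mulr_sumr; under eq_bigr do rewrite mulr_suml.
    rewrite exchange_big /=; apply: eq_bigr => k _.
    rewrite mulrCA; under eq_bigr do rewrite -mulrA.
    rewrite -mulr_sumr; congr (_ * _).
    transitivity (P k).[u%:C]; last by rewrite hQ hornerM hornerXsubC mulrC.
    by rewrite /P horner_sum; apply: eq_bigr => i _; rewrite hornerZ mulrC.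
  (* Cauchy's formula is available only as one real identity. The free scalar [kap] will be [1] and
     ['i], which recovers both parts of [c l]. *)
  have coef (kap : R[i]) l : Re (kap * c l) = 2 * pi * Im (kap * (toC (A l j)).[z]).
    pose h (t : R[i]) : R[i] := kap * \sum_j' (toC (A l j')).[t] *
      \sum_i V t (lshift q j') i * Y z i (lshift q j).
    have sh : sana [::] h.
      apply: sanaM; first exact: sana_cst.
      apply: sana_sum => j'; apply: sanaM; first exact: sana_horner.
      by apply: sana_sum => i; apply: sanaM (sV _ _) (sana_cst _ _).
    have hz : h z = kap * (toC (A l j)).[z].
      rewrite /h; congr (_ * _); rewrite (bigD1 j)//= [X in _ + X]big1 ?addr0.
        have : (V z *m Y z) (lshift q j) (lshift q j) = 1 by rewrite VY// mxE eqxx.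
        by rewrite mxE => ->; rewrite mulr1.
      move=> j' j'j; have : (V z *m Y z) (lshift q j') (lshift q j) = 0.
        by rewrite VY// mxE eq_lshift (negbTE j'j).
      by rewrite mxE => ->; rewrite mulr0.
    have bh H (u : R) : half_plane H -> bvalue H h u = kap * \sum_j' (toC (A l j')).[u%:C] *
        \sum_i boundary_value V H u (lshift q j') i * Y z i (lshift q j).
      move=> hH; have s1 j' i := sanaM (sV (lshift q j') i) (sana_cst [::] (Y z i (lshift q j))).
      have s2 j' := sana_sum (index_enum 'I_(p + q)) predT (s1 j').
      have s3 j' := sanaM (sana_horner [::] (toC (A l j'))) (s2 j').
      rewrite (bvalueM _ (sana_cst _ kap) (sana_sum _ _ s3) hH) (bvalue_cst _ _ hH).
      rewrite (bvalue_sum _ _ _ s3 hH); congr (_ * _); apply: eq_bigr => j' _.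
      rewrite (bvalueM _ (sana_horner [::] _) (s2 j') hH) (bvalue_horner _ _ hH).
      rewrite (bvalue_sum _ _ _ (s1 j') hH); congr (_ * _); apply: eq_bigr => i _.
      by rewrite (bvalueM _ (sV _ _) (sana_cst _ _) hH) (bvalue_cst _ _ hH) VbE.
    (* Only the first [p] rows of [V] jump, by [w1 j'] times the last rows weighted by [w2]; the
       factors [w1 j'] and [A l j'] assemble to [phi l], and the rest is the sum in [TE]. *)
    have jh (u : R) : bvalue upper h u - bvalue lower h u =
        - (kap * (phi l u)%:C * ((u%:C - z) * \sum_b c b * (psi b u)%:C)).
      rewrite !bh// -mulrBr -sumrB -mulrA -mulrN; congr (_ * _).
      rewrite -TE phiE rmorph_sum mulr_suml -sumrN; apply: eq_bigr => j' _.
      rewrite -mulrBr -sumrB rmorphM horner_map -mulrA -mulrN; congr (_ * _).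
      rewrite mulr_sumr -sumrN; apply: eq_bigr => i _.
      have [/(_ j') Ji _] := jump_mulE u (boundary_value V upper u) i.
      rewrite -mulrBl Vlow Ji opprD addNKr mulrA -mulNr; congr (_ * _).
      rewrite mulr_sumr; congr (- _); apply: eq_bigr => k _.
      by rewrite upB rmorphM mulrA.
    (* Row [j'] of [V] times [t^(n_j')] is bounded, while [A l j'] has degree at most [n_j' - 1],
       which leaves one power of [t] to spare. *)
    have [c' hc] : exists c', forall t, Im t != 0 -> Num.max M 1 <= cabs t ->
        cabs (h t) * cabs t <= c'.
      have /choice[K' hK'] := fun j' => @horner_growth (toC (A l j')) (nn j')
        (leq_trans (size_poly _ _) (sA l j')).
      exists (cabs kap * \sum_j' K' j' * \sum_i `|K| * cabs (Y z i (lshift q j))) => t t0.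
      rewrite ge_max => /andP[Mt t1].
      rewrite cabsM -mulrA ler_wpM2l ?cabs_ge0//.
      apply: le_trans (ler_wpM2r (cabs_ge0 t) (cabs_sum _ _ _)) _.
      rewrite mulr_suml; apply: ler_sum => j' _.
      rewrite cabsM mulrAC.
      have tn : 0 < cabs t ^+ nn j' by rewrite exprn_gt0// (lt_le_trans ltr01).
      have K'0 : 0 <= K' j'.
        have := hK' j' t t1; rewrite -ler_pdivrMr//; apply: le_trans.
        by rewrite divr_ge0 ?mulr_ge0 ?cabs_ge0// ltW.
      apply: le_trans (ler_wpM2r (cabs_ge0 _) (hK' j' t t1)) _.
      rewrite -mulrA ler_wpM2l//.
      apply: le_trans (ler_wpM2l (ltW tn) (cabs_sum _ _ _)) _.
      rewrite mulr_sumr; apply: ler_sum => i _.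
      rewrite cabsM mulrA ler_wpM2r ?cabs_ge0//.
      by have [/(_ j' i) h1 _] := VK t t0 Mt; rewrite (le_trans h1)// ler_norm.
    (* Once the Cauchy kernel has cancelled [u - z], the integrand is a finite combination of the
       products [phi l * psi b], integrable on the whole line. *)
    pose G (u : R) := \sum_b (- Re (kap * c b)) * (phi l u * psi b u).
    have GE (u : R) : Re ((bvalue upper h u - bvalue lower h u) / (u%:C - z)) = G u.
      rewrite jh.
      have uz : u%:C - z != 0 by rewrite subr_eq0; apply: contraNneq z0 => <-.
      have -> : - (kap * (phi l u)%:C * ((u%:C - z) * \sum_b c b * (psi b u)%:C)) / (u%:C - z)
          = \sum_b (- (kap * c b)) * (phi l u * psi b u)%:C.
        rewrite mulNr mulrCA mulrC mulKf// mulr_sumr -sumrN; apply: eq_bigr => b _.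
        by rewrite rmorphM; ring.
      rewrite (raddf_sum (@complex.Re R : {additive Rcomplex R -> R})) /G.
      apply: eq_bigr => b _.
      by case: (kap * c b) => c1 c2 /=; rewrite mulr0 subr0.
    have [iG IG] := Rintegral_lincomb (fun b => - Re (kap * c b)) (integrable_phi_psi l).
    have IGE : \int[mu]_u G u = - Re (kap * c l).
      rewrite /G IG (bigD1 l)//= hbi eqxx mulr1 big1 ?addr0// => b bl.
      by rewrite hbi eq_sym (negbTE bl) mulr0.
    suff e0 : \int[mu]_u G u + 2 * pi * Im (h z) = 0.
      by move: e0; rewrite IGE hz; lra.
    apply/eqP; rewrite -normr_le0; apply/ler_addgt0Pl => e ep; rewrite addr0.
    have e2 : 0 < e / 2 by rewrite divr_gt0.
    have := cvg_sint_setT (Re z) iG; move/cvgrPdist_le/(_ _ e2) => [N _ hN].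
    (* A half-side beyond these numbers meets the two thresholds of [cauchy_jump], brings its error
       below [e / 2], and is positive. *)
    pose L := Num.max (Num.max (2 * cabs z) (2 * Num.max M 1)) (Num.max (16 * c' / (e / 2)) 1).
    pose k := maxn N (Num.bound L).
    have Lk : L <= k%:R.
      have L0 : 0 <= L by rewrite (le_trans ler01)// !le_max lexx !orbT.
      by apply: le_trans (ltW (archi_boundP L0)) _; rewrite ler_nat leq_maxr.
    have := hN k (leq_maxl _ _).
    move: Lk; rewrite !ge_max => /andP[/andP[k1 k2] /andP[k3 k4]].
    have k0 : 0 < k%:R :> R by rewrite (lt_le_trans ltr01).
    have := cauchy_jump sh hc z0 isT k0 k1 k2.
    rewrite (_ : (fun u => Re _) = G); last by apply/funext => u; exact: GE.
    have ck : 16 * c' / k%:R <= e / 2 by rewrite ler_pdivrMr// [leRHS]mulrC -ler_pdivrMr.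
    move=> h1 h2; have -> : \int[mu]_u G u + 2 * pi * Im (h z) =
        (\int[mu]_u G u - sint G (Re z - k%:R) (Re z + k%:R)) +
        (sint G (Re z - k%:R) (Re z + k%:R) + 2 * pi * Im (h z)) by rewrite addrA subrK.
    by rewrite [leRHS]splitr (le_trans (ler_normD _ _))// lerD// (le_trans h1).
  (* [kap = 1] gives [Re c = 2 pi Im a] and [kap = 'i] gives [- Im c = 2 pi Re a], with [a] the
     value of [A l j] at [z]; together this is [c = - 2 pi i a]. *)
  have cl l : c l = - (2 * (pi : R)%:C * 'i%C) * (toC (A l j)).[z].
    have := coef 1 l; have := coef 'i%C l.
    case: (c l) => c1 c2; case: ((toC (A l j)).[z]) => a1 a2 /=.
    rewrite !mul0r !mul1r !add0r !subr0 !addr0 => e1 e2.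
    apply/eqP; rewrite eq_complex /=; apply/andP; split; apply/eqP; lra.
  rewrite TE mulr_sumr [RHS]mulr_sumr; apply: eq_bigr => b _; rewrite cl; ring.
(* Both sides of [claim] are sectionally analytic in [z] and agree in the upper half-plane, so their
   boundary values at [u] agree. *)
have lim j (v u : R) :
    \sum_i (\sum_k (w2 k v)%:C * (B k i).[v%:C]) * Yplus Y u i (lshift q j) =
    2 * (pi : R)%:C * 'i%C * (u - v)%:C * \sum_b (A b j).[u]%:C * (psi b v)%:C.
  have s1 i := sanaM (sana_cst [::] (\sum_k (w2 k v)%:C * (B k i).[v%:C])) (sY i (lshift q j)).
  have s2 b := sanaM (sana_horner [::] (toC (A b j))) (sana_cst [::] (psi b v)%:C).
  have s3 : sana [::] (fun z => 2 * (pi : R)%:C * 'i%C * (z - v%:C)).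
    by apply: sanaM (sana_cst _ _) (sanaD (sana_id _) (sana_cst _ _)).
  transitivity (bvalue upper (fun z => \sum_i (\sum_k (w2 k v)%:C * (B k i).[v%:C]) *
      Y z i (lshift q j)) u).
    rewrite (bvalue_sum _ _ _ s1 hU); apply: eq_bigr => i _.
    by rewrite (bvalueM _ (sana_cst _ _) (sY _ _) hU) (bvalue_cst _ _ hU) mxE.
  apply: bvalue_lim => //.
  have nc : \forall z \near bfilter upper u,
      2 * (pi : R)%:C * 'i%C * (z - v%:C) * (\sum_b (toC (A b j)).[z] * (psi b v)%:C) =
      \sum_i (\sum_k (w2 k v)%:C * (B k i).[v%:C]) * Y z i (lshift q j).
    by apply/bfilterP; exists 1 => // z zp _; rewrite claim.
  apply: cvg_trans (near_eq_cvg nc) _.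
  have -> : 2 * (pi : R)%:C * 'i%C * (u - v)%:C * (\sum_b (A b j).[u]%:C * (psi b v)%:C) =
      bvalue upper (fun z => 2 * (pi : R)%:C * 'i%C * (z - v%:C) *
        (\sum_b (toC (A b j)).[z] * (psi b v)%:C)) u.
    rewrite (bvalueM _ s3 (sana_sum _ _ s2) hU) (bvalue_sum _ _ _ s2 hU).
    rewrite (bvalueM _ (sana_cst _ _) (sanaD (sana_id [::]) (sana_cst _ _)) hU).
    rewrite (bvalueD _ (sana_id [::]) (sana_cst _ _) hU) !(bvalue_cst _ _ hU) (bvalue_id _ hU).
    rewrite rmorphB; congr (_ * _); apply: eq_bigr => b _.
    by rewrite (bvalueM _ (sana_horner [::] _) (sana_cst _ _) hU) (bvalue_cst _ _ hU)
      (bvalue_horner _ _ hU) horner_map.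
  have s4 := sanaM s3 (sana_sum (index_enum 'I_n) predT s2).
  exact: (bvalue_cvg s4 hU).
rewrite -Vup.
transitivity (\sum_j (\sum_i (\sum_k (w2 k y)%:C * (B k i).[y%:C]) * Yplus Y x i (lshift q j)) *
   (w1 j x)%:C).
  rewrite mxE big_split_ord /= [X in _ + X]big1 ?addr0; last first.
    by move=> k _; rewrite col_mxEd [X in _ * X]mxE mulr0.
  apply: eq_bigr => j _; rewrite col_mxEu [X in _ * X]mxE; congr (_ * _).
  rewrite mxE; apply: eq_bigr => i _; congr (_ * _).
  rewrite mxE big_split_ord /= big1 ?add0r; last first.
    by move=> j' _; rewrite row_mxEl [X in X * _]mxE mul0r.
  by apply: eq_bigr => k _; rewrite row_mxEr [X in X * _]mxE upB.
under eq_bigr do rewrite lim -mulrA.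
rewrite -mulr_sumr; congr (_ * _).
rewrite /CD_kernel rmorph_sum; under eq_bigr do rewrite mulr_suml.
rewrite exchange_big /=; apply: eq_bigr => b _.
rewrite phiE rmorphM rmorph_sum mulr_suml; apply: eq_bigr => j _.
by rewrite rmorphM mulrAC.
Qed.

End ReproducingKernel.

Theorem theorem4p3 (R : realType) (p q : nat) (hp : (1 <= p)%N) (hq : (1 <= q)%N)
    (w1 : 'I_p -> R -> R) (w2 : 'I_q -> R -> R)
    (hw1 : forall j, is_weight (w1 j)) (hw2 : forall k, is_weight (w2 k))
    (n : nat) (nn : 'I_p -> nat) (mm : 'I_q -> nat)
    (hnn : forall j, (0 < nn j)%N) (hmm : forall k, (0 < mm k)%N)
    (hnsum : (\sum_j nn j)%N = n) (hmsum : (\sum_k mm k)%N = n)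
    (hFL2 : weighted_span w1 nn `<=` L2 R)
    (hGL2 : weighted_span w2 mm `<=` L2 R)
    (hFdim : L2_dim n (weighted_span w1 nn))
    (hGdim : L2_dim n (weighted_span w2 mm))
    (hFG : L2_trivial_meet (weighted_span w1 nn)
             (L2_orth (weighted_span w2 mm)))
    (phi psi : 'I_n -> R -> R)
    (hphi : L2_basis (weighted_span w1 nn) phi)
    (hpsi : L2_basis (weighted_span w2 mm) psi)
    (hbi : biorthogonal phi psi)
    (Y : R[i] -> 'M[R[i]]_(p + q))
    (hY : is_RH_solution w1 w2 nn mm Y) :
  forall x y : R, x != y ->
    (CD_kernel phi psi x y)%:C =
    (2 * (pi : R)%:C * 'i%C * (x - y)%:C)^-1 *
    ((row_mx 0 (\row_k (w2 k y)%:C) : 'rV[R[i]]_(p + q))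
       *m invmx (Yplus Y y) *m Yplus Y x
       *m (col_mx (\col_j (w1 j x)%:C) 0 : 'cV[R[i]]_(p + q))) 0 0.
Proof.
move=> x y xy; rewrite (RH_kernel hnsum hmsum hFL2 hGL2 hphi hpsi hbi hY x y).
rewrite mulKf// !mulf_neq0 ?pnatr_eq0//.
- by rewrite -[0]/((0 : R)%:C) (inj_eq (@complexI R)) gt_eqF ?pi_gt0.
- by rewrite eq_complex /= oner_eq0 andbF.
- by rewrite -[0]/((0 : R)%:C) (inj_eq (@complexI R)) subr_eq0.
Qed.
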